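(* The function $\Phi\colon X\to\mathbb R$, $\Phi(x)=\lim_{n\to\infty}\log\dfrac{\langle\mathcal L_x^{n+1}\mathbb 1,\sigma\rangle}{\langle\mathcal L_{fx}^{n}\mathbb 1,\sigma\rangle}$ (for any Borel probability $\sigma$ on $Y$; the limit exists and does not depend on $\sigma$), is Hölder continuous.
   Context: Standing setting. $X$ and $Y$ are compact connected Riemannian manifolds, $X\times Y$ has the metric $d((x,y),(x',y'))=d_X(x,x')+d_Y(y,y')$. $F(x,y)=(f(x),g_x(y))$ is a skew product which is a Lipschitz local homeomorphism; $Y_x=\{x\}\times Y$ is identified with $Y$. $f$ is uniformly expanding: there are $\gamma>1$, $\delta_f>0$ with $d_X(fx,fx')\ge\gamma d_X(x,x')$ whenever $d_X(x,x')\le\delta_f$. Every $y$ has exactly $d$ preimages under each $g_x$. There is a continuous function $L(\cdot,\cdot)$ such that each $z$ has a neighbourhood $U_z$ on which $F$ is injective and the inverse of $F|_{U_z}$ is $L(z)$-Lipschitz on $F(U_z)$. There are $L\ge1$ and open $\mathcal A\subset X\times Y$ with: (A1) $L(z)\le L$ on $\mathcal A$ and $L(z)<\gamma^{-1}$ off $\mathcal A$; (A2) a finite cover $\mathcal U$ of $X\times Y$ by open sets on which $F$ is injective, with $\mathcal A$ covered by $q<d$ elements of $\mathcal U$ and each element of $\mathcal U$ meeting at most one curve of $F^{-1}(c)$ for every distance-minimizing geodesic $c$. The potential $\varphi$ is $\alpha$-Hölder ($0<\alpha<1$) satisfying (P): $\sup\varphi-\inf\varphi<\varepsilon_\varphi$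 and $|e^\varphi|_\alpha<\varepsilon_\varphi e^{\inf\varphi}$, where $0<\varepsilon_\varphi<\log d-\log q$ satisfies $s:=e^{\varepsilon_\varphi}\frac{(d-q)\gamma^{-\alpha}+qL^\alpha}{d}<1$ and $s+2s\varepsilon_\varphi\,\mathrm{diam}(Y)^\alpha<1$. Fixed: $\varepsilon>0$ with $qe^\varepsilon e^{\varepsilon_\varphi}/d<1$; $\iota\in(0,1)$ such that for some $C>0$, $\#\{w\in\{1,\dots,d\}^n:\#\{i:w_i\le q\}\ge\iota n\}\le Cq^ne^{\varepsilon n}$ for all $n$; and $L$ close enough to $1$ that some $c>0$ satisfies $\gamma^{-(1-\iota)}L^\iota<e^{-2c}<1$. Fiberwise operators: $\mathcal L_x\psi(y)=\sum_{\bar y\in g_x^{-1}(y)}e^{\varphi(x,\bar y)}\psi(\bar y)$ from $C(Y_x)$ to $C(Y_{fx})$; $\mathcal L_x^n=\mathcal L_{f^{n-1}x}\circ\cdots\circ\mathcal L_x$; $\langle\psi,\sigma\rangle=\int\psi\,d\sigma$; $\mathbb 1$ the constant function 1. *)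

(* Defs.v *)
From mathcomp Require Import all_boot all_order all_algebra.
From mathcomp Require Import all_classical all_reals all_analysis.
From mathcomp Require Import Rstruct Rstruct_topology.
From Stdlib Require Import Rdefinitions.
Import Order.TTheory GRing.Theory Num.Theory.
Import numFieldNormedType.Exports.

Set Implicit Arguments.
Unset Strict Implicit.
Unset Printing Implicit Defensive.

Local Open Scope classical_set_scope.
Local Open Scope ring_scope.

Notation R := Rdefinitions.R.

Definition is_metric {T : Type} (d : T -> T -> R) : Prop :=
  (forall x y, 0 <= d x y) /\ (forall x y, d x y = 0 <-> x = y) /\
  (forall x y, d x y = d y x) /\ (forall x y z, d x z <= d x y + d y z).

Definition mopen {T : Type} (d : T -> T -> R) (U : set T) : Prop :=
  forall x, U x -> exists2 r : R, 0 < r & forall y, d x y < r -> U y.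

(* sequential compactness (= compactness for metric spaces) *)
Definition mcompact {T : Type} (d : T -> T -> R) : Prop :=
  forall u : nat -> T, exists (phi : nat -> nat) (l : T),
    (forall n, ltn (phi n) (phi n.+1)) /\
    forall e : R, 0 < e -> exists N : nat, forall n, leq N n -> d (u (phi n)) l < e.

Definition mconnected {T : Type} (d : T -> T -> R) : Prop :=
  forall U V : set T, mopen d U -> mopen d V -> U `&` V = set0 -> U `|` V = setT ->
    U = set0 \/ V = set0.

Definition mcont_on {S T : Type} (dS : S -> S -> R) (dT : T -> T -> R)
  (D : set S) (h : S -> T) : Prop :=
  forall x, D x -> forall e : R, 0 < e -> exists2 r : R, 0 < r &
    forall y, D y -> dS x y < r -> dT (h x) (h y) < e.

Definition homeo_onto {S T : Type} (dS : S -> S -> R) (dT : T -> T -> R)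
  (U : set S) (V : set T) (h : S -> T) : Prop :=
  exists k : T -> S,
    (forall x, U x -> V (h x) /\ k (h x) = x) /\
    (forall y, V y -> U (k y) /\ h (k y) = y) /\
    mcont_on dS dT U h /\ mcont_on dT dS V k.

Definition euclid_dist (n : nat) (u v : 'rV[R]_n) : R := `|u - v|.

Definition topological_manifold {T : Type} (d : T -> T -> R) : Prop :=
  exists n : nat, forall x : T, exists (U : set T) (V : set 'rV[R]_n)
    (chart : T -> 'rV[R]_n),
    [/\ mopen d U, U x, mopen (@euclid_dist n) V & homeo_onto d (@euclid_dist n) U V chart].

Definition min_geodesic {T : Type} (d : T -> T -> R) (l : R) (c : R -> T) : Prop :=
  0 <= l /\ forall s t, 0 <= s <= l -> 0 <= t <= l -> d (c s) (c t) = `|s - t|.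

Definition geodesic_space {T : Type} (d : T -> T -> R) : Prop :=
  forall x y : T, exists c : R -> T, min_geodesic d (d x y) c /\ c 0 = x /\ c (d x y) = y.

(* Stand-in for "compact connected Riemannian manifold". *)
Definition compact_connected_manifold {T : Type} (d : T -> T -> R) : Prop :=
  [/\ is_metric d, mcompact d, mconnected d, topological_manifold d & geodesic_space d].

Definition dprod {X Y : Type} (dX : X -> X -> R) (dY : Y -> Y -> R)
  (z z' : X * Y) : R := dX z.1 z'.1 + dY z.2 z'.2.

Definition skewF {X Y : Type} (f : X -> X) (g : X -> Y -> Y) (z : X * Y) : X * Y :=
  (f z.1, g z.1 z.2).

Definition injective_on {S T : Type} (D : set S) (h : S -> T) : Prop :=
  forall x y, D x -> D y -> h x = h y -> x = y.

Definition lipschitz_map {S T : Type} (dS : S -> S -> R) (dT : T -> T -> R)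
  (h : S -> T) : Prop :=
  exists K : R, forall x y, dT (h x) (h y) <= K * dS x y.

Definition local_homeomorphism {S : Type} (d : S -> S -> R) (h : S -> S) : Prop :=
  forall z, exists U : set S, [/\ mopen d U, U z, mopen d (h @` U) & homeo_onto d d U (h @` U) h].

Definition holder {S : Type} (d : S -> S -> R) (a : R) (h : S -> R) : Prop :=
  exists H : R, forall x y, `|h x - h y| <= H * (d x y) `^ a.

Definition holder_continuous {S : Type} (d : S -> S -> R) (h : S -> R) : Prop :=
  exists a : R, 0 < a /\ holder d a h.

Definition holder_seminorm {S : Type} (d : S -> S -> R) (a : R) (h : S -> R) : R :=
  sup [set r : R | exists x y, x <> y /\ r = `|h x - h y| / (d x y) `^ a].

Definition diam {S : Type} (d : S -> S -> R) : R :=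
  sup [set r : R | exists x y, r = d x y].

Definition Lop {X Y : choiceType} (g : X -> Y -> Y) (phi : X * Y -> R)
  (x : X) (psi : Y -> R) : Y -> R :=
  fun y => \sum_(yb \in g x @^-1` [set y]) expR (phi (x, yb)) * psi yb.

Fixpoint Lopn {X Y : choiceType} (f : X -> X) (g : X -> Y -> Y) (phi : X * Y -> R)
  (n : nat) (x : X) (psi : Y -> R) : Y -> R :=
  match n with
  | 0 => psi
  | m.+1 => Lop g phi (iter m f x) (Lopn f g phi m x psi)
  end.

Definition borel_of {T : Type} (d : T -> T -> R) : set (set T) := [set U | mopen d U].

Definition pairing {Y : pointedType} (dY : Y -> Y -> R)
  (sigma : probability (g_sigma_algebraType (borel_of dY)) R) (psi : Y -> R) : R :=
  fine (\int[sigma]_y (psi y)%:E)%E.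

(* Main.v *)
(* By (A2), lifting a minimizing geodesic of a fibre through the d inverse branches pairs the
   preimages of any two of its points so that all but q of the pairs are contracted by
   gamma^-1 and the others are expanded by at most Lc.  With (P), the fibre operators then map
   the cone of functions with Holder seminorm at most k times their infimum into the same cone
   for a smaller constant.  If psi - a chi and b chi - psi lie in the cone, one of their images
   dominates a fixed fraction of (b - a) L chi in the cone order, so the gap b - a shrinks by a
   fixed factor at each step (Birkhoff contraction without the Hilbert metric).  Applied to
   psi = L_x 1 and chi = 1 this gives exponential convergence of the log ratios, uniformly in x
   and sigma.
   The n-th log ratio is Holder on the scale Lam^-n, with constant of order Lam^(n alpha):
   the branches over nearby base points are paired by local inverses of the skew product and
   compared by the cone condition.  Interpolating between the two estimates gives some Holder
   exponent for the limit. *)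

Require Import Defs.
From mathcomp Require Import all_boot all_order all_algebra.
From mathcomp Require Import all_classical all_reals all_analysis.
From mathcomp Require Import Rstruct Rstruct_topology.
From mathcomp Require Import ring lra.
Import Order.TTheory GRing.Theory Num.Theory.
Import numFieldNormedType.Exports.
Local Open Scope classical_set_scope.
Local Open Scope ring_scope.

(** * Compact metric spaces *)

Section Metric.
Context {T : Type} {d : T -> T -> R} (dM : is_metric d).

Lemma mdist_ge0 x y : 0 <= d x y. Proof. by case: dM => H _; apply: H. Qed.

Lemma mdist_eq0 x y : d x y = 0 -> x = y.
Proof. by case: dM => _ [H _]; case: (H x y). Qed.

Lemma mdistxx x : d x x = 0.
Proof. by case: dM => _ [H _]; case: (H x x) => _; apply. Qed.

Lemma mdistC x y : d x y = d y x.
Proof. by case: dM => _ [_ [H _]]; apply: H. Qed.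

Lemma mdist_triangle z x y : d x y <= d x z + d z y.
Proof. by case: dM => _ [_ [_ H]]; apply: H. Qed.

Lemma mdist_triangle_r z x y : d x y <= d z x + d z y.
Proof. by rewrite (mdistC z x); apply: mdist_triangle. Qed.

Lemma incr_seq_ge (k : nat -> nat) n :
  (forall n, ltn (k n) (k n.+1)) -> (n <= k n)%N.
Proof. by move=> Hk; elim: n => // n IH; apply: leq_ltn_trans IH (Hk n). Qed.

(** Lebesgue number argument: failures at the scales [1/(n+1)] would have a subsequence converging
    to some [l], and the radius valid around [l] rules out all late ones. *)
Lemma compact_uniform (Q : R -> T -> Prop) : mcompact d ->
  (forall r r' w, r' <= r -> Q r w -> Q r' w) ->
  (forall z, exists2 r, 0 < r & forall w, d z w < r -> Q r w) ->
  exists2 r, 0 < r & forall w, Q r w.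
Proof.
move=> dC Qmono Qloc; apply: contrapT => nQ.
have bad n : {w | ~ Q n.+1%:R^-1 w}.
  apply: cid; apply: contrapT => /forallNP H; apply: nQ.
  by exists n.+1%:R^-1 => [|w]; [rewrite invr_gt0 ltr0n | apply: contrapT (H w)].
have [k [l [kI kl]]] := dC (fun n => sval (bad n)).
have [r r0 Hr] := Qloc l.
have [N HN] := kl r r0.
have [M HM] : exists M : nat, M.+1%:R^-1 < r.
  by exists (Num.truncn r^-1); rewrite -ltf_pV2 ?posrE ?invr_gt0 ?ltr0n // invrK truncnS_gt.
pose n := maxn N M.
have /= := svalP (bad (k n)); apply.
apply: (@Qmono r); last by apply: Hr; rewrite mdistC; apply: HN; exact: leq_maxl.
apply: le_trans (ltW HM); rewrite lef_pV2 ?posrE ?ltr0n // ler_nat ltnS.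
exact: leq_trans (leq_maxr N M) (incr_seq_ge _ _ kI).
Qed.

Lemma compact_bounded : mcompact d -> exists D, forall x y, d x y <= D.
Proof.
move=> dC; case: (pselect (exists z0 : T, True)) => [[z0 _]|nT]; last first.
  by exists 0 => x; case: nT; exists x.
(* The bound on the distance to [z0] is written as [r^-1], so that it weakens as [r] decreases. *)
have [||r r0 Hr] := compact_uniform (fun r w => 0 < r -> d z0 w < r^-1) dC.
- move=> r r' w rr' Q r'0; apply: lt_le_trans (Q (lt_le_trans r'0 rr')) _.
  by rewrite lef_pV2 ?posrE // (lt_le_trans r'0).
- move=> z; have p : 0 < d z0 z + 2 by rewrite ltr_wpDl // mdist_ge0.
  exists (d z0 z + 2)^-1; first by rewrite invr_gt0.
  move=> w zw _; rewrite invrK; apply: le_lt_trans (mdist_triangle z _ _) _.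
  rewrite ltrD2l; apply: lt_trans zw _; rewrite invf_plt ?posrE //.
  by have := mdist_ge0 z0 z; lra.
- exists (r^-1 + r^-1) => x y; apply: le_trans (mdist_triangle_r z0 _ _) _.
  by apply: lerD; apply/ltW/Hr.
Qed.

End Metric.

(* The [+] in the definition of [dprod] is parsed as Stdlib's [Rplus]. *)
Lemma dprodE {X Y : Type} (dX : X -> X -> R) (dY : Y -> Y -> R) z z' :
  dprod dX dY z z' = dX z.1 z'.1 + dY z.2 z'.2.
Proof. by []. Qed.

Lemma dprod_metric {X Y : Type} {dX : X -> X -> R} {dY : Y -> Y -> R} :
  is_metric dX -> is_metric dY -> is_metric (dprod dX dY).
Proof.
move=> mX mY; split=> [x y|]; first by rewrite dprodE addr_ge0 ?(mdist_ge0 mX) ?(mdist_ge0 mY).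
split=> [[x1 x2] [y1 y2]|]; last split=> [x y|x y z].
- split=> [|[-> ->]]; last by rewrite dprodE /= (mdistxx mX) (mdistxx mY) addr0.
  rewrite dprodE /=; have := mdist_ge0 mX x1 y1; have := mdist_ge0 mY x2 y2.
  move=> h1 h2 h3; have e1 : dX x1 y1 = 0 by lra.
  have e2 : dY x2 y2 = 0 by lra.
  by rewrite (mdist_eq0 mX _ _ e1) (mdist_eq0 mY _ _ e2).
- by rewrite !dprodE (mdistC mX) (mdistC mY).
- rewrite !dprodE; have := mdist_triangle mX y.1 x.1 z.1.
  by have := mdist_triangle mY y.2 x.2 z.2; lra.
Qed.

Lemma dprod_compact {X Y : Type} {dX : X -> X -> R} {dY : Y -> Y -> R} :
  mcompact dX -> mcompact dY -> mcompact (dprod dX dY).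
Proof.
move=> cX cY u.
have [k1 [l1 [k1I H1]]] := cX (fun n => (u n).1).
have [k2 [l2 [k2I H2]]] := cY (fun n => (u (k1 n)).2).
have k1lt m n : (m < n)%N -> (k1 m < k1 n)%N.
  elim: n => // n IH; rewrite ltnS leq_eqVlt => /orP[/eqP->|/IH h];
    [exact: k1I|exact: ltn_trans h (k1I n)].
exists (k1 \o k2), (l1, l2); split=> [n|e e0]; first exact: k1lt (k2I n).
have e2 : 0 < e / 2 by rewrite divr_gt0.
have [N1 HN1] := H1 _ e2; have [N2 HN2] := H2 _ e2.
exists (maxn N1 N2) => n; rewrite geq_max => /andP[n1 n2].
have := HN1 (k2 n) (leq_trans n1 (incr_seq_ge _ _ k2I)); have := HN2 n n2.
by rewrite dprodE /=; lra.
Qed.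

(** * Inverse branches and lifted geodesics *)

(** Continuous induction: let [s] be the supremum of the times [t] at which
    [d (c 0) (c t) <= M * t]. The local estimate around [s] shows that the bound holds at [s], and
    also slightly beyond [s] if [s < l]. *)
Lemma local_to_global_dist {T : Type} {d : T -> T -> R} (dM : is_metric d)
    (c : R -> T) (l M : R) : 0 <= l ->
  (forall t, 0 <= t <= l -> exists2 e, 0 < e &
     forall u v, 0 <= u <= l -> 0 <= v <= l -> `|u - t| < e -> `|v - t| < e ->
     u <= v -> d (c u) (c v) <= M * (v - u)) ->
  d (c 0) (c l) <= M * l.
Proof.
move=> l0 loc.
pose S := [set t : R | 0 <= t <= l /\ d (c 0) (c t) <= M * t].
have S0 : S 0 by split; [rewrite lexx|rewrite (mdistxx dM) mulr0].
have Sub : ubound S l by move=> t [/andP[]].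
have hS : has_sup S by split; [exists 0|exists l].
pose s := sup S.
have sl : s <= l by apply: ge_sup => //; exists 0.
have s0 : 0 <= s by apply: ub_le_sup => //; exists l.
have s0l : 0 <= s <= l by apply/andP.
have [e e0 He] := loc s s0l.
have Ss : S s.
  have [t St ts] := sup_adherent e0 hS.
  have tle : t <= s by apply: ub_le_sup => //; exists l.
  case: (St) => tl Ht; split=> //.
  apply: le_trans (mdist_triangle dM (c t) _ _) _.
  have := He t s tl s0l; rewrite subrr normr0 ler0_norm ?subr_le0 //.
  rewrite opprB => /(_ _ e0 tle) H.
  have : s - t < e by rewrite -/s in ts; lra.
  by move=> /H; lra.
have [ls|ls] := leP l s.
  by have -> : l = s by [apply/eqP; rewrite eq_le ls sl]; case: Ss.
pose v := Num.min l (s + e / 2).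
have sv : s < v by rewrite lt_min ls /=; lra.
have vl : v <= l by rewrite ge_min lexx.
have ve : v <= s + e / 2 by rewrite ge_min lexx orbT.
have v0l : 0 <= v <= l by rewrite vl andbT; lra.
suff /(ub_le_sup (ex_intro _ l Sub)) : S v by rewrite -/s; lra.
split=> //; apply: le_trans (mdist_triangle dM (c s) _ _) _.
have := He s v s0l v0l; rewrite subrr normr0 ger0_norm ?subr_ge0 ?(ltW sv) //.
move=> /(_ e0); have : v - s < e by lra.
by move=> h /(_ h isT); case: Ss; lra.
Qed.

Section Fibres.
Context {X Y : Type} {dX : X -> X -> R} {dY : Y -> Y -> R}.
Context {f : X -> X} {g : X -> Y -> Y} {gamma delta_f : R} {Lfun : X * Y -> R}.
Hypotheses (mX : is_metric dX) (mY : is_metric dY).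
Hypotheses (cX : mcompact dX) (cY : mcompact dY).
Hypothesis HFlip : lipschitz_map (dprod dX dY) (dprod dX dY) (skewF f g).
Hypothesis HFloc : local_homeomorphism (dprod dX dY) (skewF f g).
Hypotheses (Hgamma : 1 < gamma) (Hdelta : 0 < delta_f).
Hypothesis Hexp : forall x x', dX x x' <= delta_f -> dX (f x) (f x') >= gamma * dX x x'.
Hypothesis HLloc : forall z, exists U : set (X * Y),
     [/\ mopen (dprod dX dY) U, U z, injective_on U (skewF f g) &
      forall w w', U w -> U w' ->
        dprod dX dY w w' <= Lfun z * dprod dX dY (skewF f g w) (skewF f g w')].

Let mZ := dprod_metric mX mY.
Let cZ := dprod_compact cX cY.

Lemma skew_lipschitz : exists2 Lam, 1 <= Lam & forall w w',
  dprod dX dY (skewF f g w) (skewF f g w') <= Lam * dprod dX dY w w'.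
Proof.
have [K HK] := HFlip; exists (Num.max 1 K); first by rewrite le_max lexx.
move=> w w'; apply: le_trans (HK w w') _.
by rewrite ler_wpM2r ?(mdist_ge0 mZ) // le_max lexx orbT.
Qed.

Lemma skew_locally_injective : exists2 r, 0 < r & forall w w',
  dprod dX dY w w' < r -> skewF f g w = skewF f g w' -> w = w'.
Proof.
apply: (compact_uniform mZ (fun r w => forall w', dprod dX dY w w' < r ->
  skewF f g w = skewF f g w' -> w = w')) => //.
- by move=> r r' w rr' H w' ww'; apply: H; apply: lt_le_trans ww' rr'.
- move=> z; have [U [Uo Uz Ui _]] := HLloc z.
  have [r r0 Hr] := Uo z Uz; exists (r / 2); first by rewrite divr_gt0.
  move=> w zw w' ww'; apply: Ui; apply: Hr; first by lra.
  by have := mdist_triangle mZ w z w'; lra.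
Qed.

Lemma skew_inverse_branch : exists2 r, 0 < r & forall w v,
  dprod dX dY (skewF f g w) v < r ->
  exists2 w', skewF f g w' = v & dprod dX dY w w' <= r^-1 * dprod dX dY (skewF f g w) v.
Proof.
(* One number [r] encodes both the radius and, inverted, the Lipschitz constant, so the property is
   monotone in [r] as the compactness argument requires. *)
pose Q r w := 0 < r -> forall v, dprod dX dY (skewF f g w) v < r ->
  exists2 w', skewF f g w' = v & dprod dX dY w w' <= r^-1 * dprod dX dY (skewF f g w) v.
have [||r r0 Hr] := compact_uniform mZ Q cZ; last by exists r => // w; apply: Hr.
- move=> r r' w rr' H r'0 v wv.
  have r0 := lt_le_trans r'0 rr'.
  have [w' e Hw'] := H r0 v (lt_le_trans wv rr'); exists w' => //.
  apply: le_trans Hw' _; rewrite ler_wpM2r ?(mdist_ge0 mZ) //.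
  by rewrite lef_pV2.
- move=> z; have [U [Uo Uz Ui HL]] := HLloc z.
  have [V [Vo Vz FVo [k [HV1 [HV2 [_ kc]]]]]] := HFloc z.
  have [r1 r10 Hr1] := Uo z Uz.
  have FVz : (skewF f g @` V) (skewF f g z) by exists z.
  have [r2 r20 Hr2] := kc _ FVz r1 r10.
  have [r3 r30 Hr3] := FVo _ FVz.
  have [Lam Lam1 HLam] := skew_lipschitz.
  have Lam0 : 0 < Lam + 1 by lra.
  pose M := `|Lfun z| + 1.
  have M0 : 0 < M by rewrite ltr_wpDl.
  (* [r1] is the radius of the Lipschitz neighbourhood [U], [r2] comes from continuity of the local
     inverse [k], and [r3] keeps [v] in the image of [V]. The factor [Lam + 1] arises because [v] is
     near the image of [w], which is itself within [Lam * r] of the image of [z]. *)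
  pose r := Num.min (Num.min r1 M^-1) (Num.min (r2 / (Lam + 1)) (r3 / (Lam + 1))).
  have r0 : 0 < r by rewrite !lt_min r10 invr_gt0 M0 !divr_gt0.
  exists r => // w zw _ v wv.
  have [rr1 rM rr2 rr3] : [/\ r <= r1, r <= M^-1, r * (Lam + 1) <= r2 & r * (Lam + 1) <= r3].
    by rewrite -!ler_pdivlMr // /r; split; rewrite !ge_min lexx ?orbT.
  have zv : dprod dX dY (skewF f g z) v < r * (Lam + 1).
    have := mdist_triangle mZ (skewF f g w) (skewF f g z) v.
    have := HLam z w; have : Lam * dprod dX dY z w <= Lam * r by rewrite ler_wpM2l; lra.
    lra.
  have FVv : (skewF f g @` V) v by apply: Hr3; lra.
  have [Vk Fk] := HV2 v FVv.
  exists (k v) => //.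
  have kz : k (skewF f g z) = z by have [] := HV1 z Vz.
  have Uk : U (k v).
    by apply: Hr1; rewrite -{1}kz; apply: Hr2 => //; lra.
  have Uw : U w by apply: Hr1; lra.
  have := HL w (k v) Uw Uk; rewrite Fk => H; apply: le_trans H _.
  rewrite ler_wpM2r ?(mdist_ge0 mZ) //.
  apply: (@le_trans _ _ M); first by rewrite /M; have := ler_norm (Lfun z); lra.
  by rewrite -[M]invrK lef_pV2 ?posrE ?invr_gt0.
Qed.

Lemma fibre_locally_injective : exists2 r, 0 < r & forall x y y',
  dY y y' < r -> g x y = g x y' -> y = y'.
Proof.
have [r r0 Hr] := skew_locally_injective; exists r => // x y y' yy' e.
have [] // : (x, y) = (x, y').
by apply: Hr; [rewrite dprodE /= (mdistxx mX) add0r | rewrite /skewF /= e].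
Qed.

(** An inverse branch of the skew product towards [(f x', v)] could land over another preimage [x'']
    of [f x']. Since [x''] is within [delta_f] of [x'], expansion of [f] forces [x'' = x']. *)
Lemma fibre_inverse_branch : exists2 r, 0 < r & exists2 K, 0 <= K &
  forall x x' y v, dX x x' < r -> dY (g x y) v < r ->
  exists2 y', g x' y' = v & dY y y' <= K * (dX (f x) (f x') + dY (g x y) v).
Proof.
have [r0 r00 Hr0] := skew_inverse_branch.
have [Lam Lam1 HLam] := skew_lipschitz.
pose K := r0^-1; have K0 : 0 < K by rewrite invr_gt0.
have L0 : 0 < Lam + 1 by lra.
have p0 : 0 < 1 + K * (Lam + 1) by rewrite ltr_pwDl // mulr_ge0 // ltW.
(* The first bound makes the inverse branch available; the second keeps [x'] and [x''] within the
   expansion scale. *)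
pose r := Num.min (r0 / (Lam + 1)) (delta_f / (1 + K * (Lam + 1))).
have rp : 0 < r by rewrite lt_min !divr_gt0.
have [rr0 rd] : r * (Lam + 1) <= r0 /\ r * (1 + K * (Lam + 1)) <= delta_f.
  by rewrite -!ler_pdivlMr // /r; split; rewrite !ge_min lexx ?orbT.
exists r => //; exists K => [|x x' y v xx' yv]; first exact: ltW.
have fx : dX (f x) (f x') <= Lam * dX x x'.
  have := HLam (x, y) (x', y); rewrite !dprodE /= (mdistxx mY) addr0.
  by have := mdist_ge0 mY (g x y) (g x' y); lra.
have fxr : dX (f x) (f x') < Lam * r.
  by apply: le_lt_trans fx _; rewrite ltr_pM2l //; lra.
have [|[x'' y']] := Hr0 (x, y) (f x', v); first by rewrite dprodE /=; lra.
move=> [fx'' gx''] H.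
suff e : x' = x''.
  exists y'; first by rewrite e.
  by move: H; rewrite !dprodE /= -/K; have := mdist_ge0 mX x x''; lra.
apply: (mdist_eq0 mX); apply/eqP; rewrite eq_le (mdist_ge0 mX) andbT.
have small : dX x' x'' <= delta_f.
  move: H; rewrite !dprodE /= -/K; have := mdist_ge0 mY y y'.
  have : K * (dX (f x) (f x') + dY (g x y) v) <= K * (r * (Lam + 1)).
    by rewrite ler_wpM2l ?ltW //; lra.
  by have := mdist_triangle_r mX x x' x''; lra.
have := Hexp _ _ small; rewrite fx'' (mdistxx mX).
have g0 : 0 < gamma by apply: lt_trans Hgamma.
by rewrite pmulr_rle0.
Qed.

(** The curve is lifted in time steps of a fixed length [eta], which depends neither on the fibre
    nor on the curve because the radii of the inverse branches are uniform. *)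
Lemma fibre_path_lift : exists2 K, 0 <= K & forall x l (c : R -> Y) y0, 0 <= l ->
  (forall s t, 0 <= s -> s <= t -> t <= l -> dY (c s) (c t) <= t - s) ->
  g x y0 = c 0 ->
  exists b : R -> Y, [/\ b 0 = y0, forall t, 0 <= t <= l -> g x (b t) = c t &
    forall s t, 0 <= s -> s <= t -> t <= l -> dY (b s) (b t) <= K * (t - s)].
Proof.
have [r r0 [K K0 branch]] := fibre_inverse_branch.
have [r1 r10 inj] := fibre_locally_injective.
exists K => // x l c y0 l0 c1 cy0.
have K3 : 0 < 3 * K + 1 by lra.
(* [eta < r] lets an inverse branch reach every point of a step; [3 * K * eta < r1] is what the
   uniqueness argument below uses. *)
pose eta := Num.min (r / 2) (r1 / (3 * K + 1)).
have eta0 : 0 < eta by rewrite lt_min !divr_gt0.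
have [etar etaK] : eta < r /\ eta * (3 * K + 1) <= r1.
  rewrite -ler_pdivlMr // /eta ge_min lexx orbT; split=> //.
  by rewrite gt_min; apply/orP; left; lra.
have branchx y v : dY (g x y) v < r ->
    exists2 y', g x y' = v & dY y y' <= K * dY (g x y) v.
  by move=> /(branch x x); rewrite !(mdistxx mX) add0r; apply.
pose good T (b : R -> Y) := [/\ b 0 = y0, forall t, 0 <= t <= T -> g x (b t) = c t &
    forall s t, 0 <= s -> s <= t -> t <= T -> dY (b s) (b t) <= K * (t - s)].
suff lift n : exists b, good (Num.min (n%:R * eta) l) b.
  have [b] := lift (Num.truncn (l / eta)).+1; rewrite /good.
  rewrite min_r; first by exists b.
  by rewrite -ler_pdivrMr // ltW // truncnS_gt.
elim: n => [|n [b [b0 bc bK]]].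
  exists (fun=> y0); rewrite mul0r min_l //; split=> // [t t0|s t s0 st t0].
    by have -> : t = 0 by lra.
  by rewrite (mdistxx mY) mulr_ge0 // subr_ge0.
have [nl|nl] := leP l (n%:R * eta).
  have nl' : l <= n.+1%:R * eta by apply: le_trans nl _; rewrite ler_pM2r // ler_nat.
  by exists b; move: bc bK; rewrite !min_r.
set T := n%:R * eta in nl *.
have T0 : 0 <= T by rewrite mulr_ge0 // ltW.
rewrite min_l // in bc bK; last exact: ltW.
have -> : n.+1%:R * eta = T + eta by rewrite /T -natr1 mulrDl mul1r.
set T' := Num.min _ _.
have [T'l T'T] : T' <= l /\ T' <= T + eta by rewrite !ge_min !lexx orbT.
have TT0 : 0 <= T <= T by rewrite T0 lexx.
have bT := bc T TT0.
have ext t : T <= t <= T' -> exists2 y', g x y' = c t & dY (b T) y' <= K * (t - T).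
  move=> /andP[Tt tT']; have ct : dY (g x (b T)) (c t) <= t - T by rewrite bT c1 //; lra.
  have [|y' e Hy'] := branchx (b T) (c t); first by lra.
  by exists y' => //; apply: le_trans Hy' _; rewrite ler_wpM2l.
have /choice[h Hh] : forall t, exists y', T <= t <= T' ->
    g x y' = c t /\ dY (b T) y' <= K * (t - T).
  move=> t; case: (pselect (T <= t <= T')) => [/ext[y' ? ?]|nt]; first by exists y'.
  by exists y0 => /nt.
have hK s t : T <= s -> s <= t -> t <= T' -> dY (h s) (h t) <= K * (t - s).
  move=> Ts st tT'.
  have sTT : T <= s <= T' by lra.
  have tTT : T <= t <= T' by lra.
  have [gs ds] := Hh s sTT; have [gt dt] := Hh t tTT.
  have ct : dY (g x (h s)) (c t) <= t - s by rewrite gs c1 //; lra.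
  have [|y' e Hy'] := branchx (h s) (c t); first by lra.
  have hy' : dY (h s) y' <= K * (t - s) by apply: le_trans Hy' _; rewrite ler_wpM2l.
  (* The values of [h] were chosen pointwise from [b T]. The preimage of [c t] reached from [h s] is
     within [3 * K * eta] of [h t], hence equal to it by local injectivity; this makes [h]
     Lipschitz. *)
  suff <- : y' = h t by [].
  apply: (inj x); last by rewrite e gt.
  have Ks : K * (s - T) <= K * eta by rewrite ler_wpM2l //; lra.
  have Kt : K * (t - T) <= K * eta by rewrite ler_wpM2l //; lra.
  have Kst : K * (t - s) <= K * eta by rewrite ler_wpM2l //; lra.
  have := mdist_triangle mY (h s) y' (h t); have := mdist_triangle mY (b T) (h s) (h t).
  by rewrite (mdistC mY y' (h s)) (mdistC mY (h s) (b T)); lra.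
pose b' t := if t <= T then b t else h t.
exists b'; split.
- by rewrite /b' T0.
- move=> t /andP[t0 tT']; rewrite /b'; case: leP => tT; first by apply: bc; rewrite t0.
  by case: (Hh t) => //; rewrite tT' ltW.
- move=> s t s0 st tT'; rewrite /b'; have [tT|tT] := leP t T.
    by rewrite (le_trans st tT); apply: bK.
  have [sT|sT] := leP s T; last by apply: hK => //; exact: ltW.
  apply: le_trans (mdist_triangle mY (b T) _ _) _.
  have := bK s T s0 sT (lexx T).
  have [] := Hh t; first by rewrite (ltW tT).
  by lra.
Qed.

(** The crude constant [K] only keeps short pieces of the lift inside the neighbourhoods where the
    inverse is [Lfun]-Lipschitz; the sharp constant [M] then comes from those neighbourhoods. *)
Lemma lift_length x l (c b : R -> Y) K M : 0 <= l -> 0 <= K -> 0 <= M ->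
  (forall s t, 0 <= s -> s <= t -> t <= l -> dY (c s) (c t) <= t - s) ->
  (forall t, 0 <= t <= l -> g x (b t) = c t) ->
  (forall s t, 0 <= s -> s <= t -> t <= l -> dY (b s) (b t) <= K * (t - s)) ->
  (forall t, 0 <= t <= l -> Lfun (x, b t) <= M) ->
  dY (b 0) (b l) <= M * l.
Proof.
move=> l0 K0 M0 c1 bc bK LM; apply: (local_to_global_dist mY) => // t tl.
have [U [Uo Ut _ UL]] := HLloc (x, b t).
have [r r0 Hr] := Uo _ Ut.
have K1 : 0 < K + 1 by lra.
have near u : 0 <= u <= l -> `|u - t| < r / (K + 1) -> U (x, b u).
  move=> ul; rewrite ltr_pdivlMr // => ut.
  apply: Hr; rewrite dprodE /= (mdistxx mX) add0r.
  have [h|h] := leP u t.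
    rewrite (mdistC mY); have := bK u t; rewrite ler0_norm in ut; last by lra.
    by move=> /(_ _ h); lra.
  have := bK t u; rewrite ger0_norm in ut; last by lra.
  by move=> /(_ _ (ltW h)); lra.
exists (r / (K + 1)); first by rewrite divr_gt0.
move=> u v ul vl ut vt uv.
have := UL _ _ (near u ul ut) (near v vl vt).
rewrite !dprodE /skewF /= !(mdistxx mX) !add0r !bc // => H; apply: le_trans H _.
have cuv : dY (c u) (c v) <= v - u by apply: c1; lra.
apply: (@le_trans _ _ (M * dY (c u) (c v))).
  by rewrite ler_wpM2r ?(mdist_ge0 mY) // LM.
by rewrite ler_wpM2l.
Qed.

End Fibres.

(** * Pairing the preimages of two points *)

Lemma enum_of_card {Y : pointedType} {A : set Y} {d : nat} : (A #= `I_d)%card ->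
  exists e : 'I_d -> Y, [/\ injective e, forall i, A (e i) &
    forall y, A y -> exists i, e i = y].
Proof.
move=> /card_esym/card_set_bijP[h [hfun hinj hsurj]].
exists (fun i : 'I_d => h i); split.
- by move=> i j /hinj hij; apply/val_inj/hij; rewrite inE /=.
- by move=> i; apply: hfun => /=.
- by move=> y /hsurj[k kd <-]; exists (Ordinal kd).
Qed.

Section Pairings.
Context {X Y : pointedType} {dX : X -> X -> R} {dY : Y -> Y -> R}.
Context {f : X -> X} {g : X -> Y -> Y} {d : nat} {gamma delta_f : R} {Lfun : X * Y -> R}.
Hypotheses (mX : is_metric dX) (mY : is_metric dY).
Hypotheses (cX : mcompact dX) (cY : mcompact dY).
Hypothesis HFlip : lipschitz_map (dprod dX dY) (dprod dX dY) (skewF f g).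
Hypothesis HFloc : local_homeomorphism (dprod dX dY) (skewF f g).
Hypotheses (Hgamma : 1 < gamma) (Hdelta : 0 < delta_f).
Hypothesis Hexp : forall x x', dX x x' <= delta_f -> dX (f x) (f x') >= gamma * dX x x'.
Hypothesis Hdeg : forall x y, (g x @^-1` [set y] #= `I_d)%card.
Hypothesis HLloc : forall z, exists U : set (X * Y),
     [/\ mopen (dprod dX dY) U, U z, injective_on U (skewF f g) &
      forall w w', U w -> U w' ->
        dprod dX dY w w' <= Lfun z * dprod dX dY (skewF f g w) (skewF f g w')].

Lemma base_lipschitz : exists2 Lam, 1 <= Lam & forall x x', dX (f x) (f x') <= Lam * dX x x'.
Proof.
have [Lam Lam1 HLam] := skew_lipschitz (f := f) (g := g) mX mY HFlip.
exists Lam => // x x'; have := HLam (x, point) (x', point).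
rewrite !dprodE /= (mdistxx mY) addr0.
by have := mdist_ge0 mY (g x point) (g x' point); lra.
Qed.

(** Each preimage over [x] is followed by an inverse branch to the fibre over [x']. Two branches
    cannot merge: their starting points would be distinct preimages of [y] within the injectivity
    radius [r1]. *)
Lemma nearby_fibres_pairing : exists2 r, 0 < r & exists2 K, 0 <= K &
  forall x x' y, dX x x' < r -> exists e e' : 'I_d -> Y,
    [/\ injective e, injective e', forall i, g x (e i) = y, forall i, g x' (e' i) = y &
      forall i, dY (e i) (e' i) <= K * dX x x'].
Proof.
have [Lam Lam1 HLam] := base_lipschitz.
have [r0 r00 [K K0 branch]] :=
  fibre_inverse_branch mX mY cX cY HFlip HFloc Hgamma Hdelta Hexp HLloc.
have [r1 r10 inj] := fibre_locally_injective mX mY cX cY HLloc.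
have KL : 0 <= K * Lam by rewrite mulr_ge0 //; lra.
have KL1 : 0 < 2 * (K * Lam) + 1 by lra.
exists (Num.min r0 (r1 / (2 * (K * Lam) + 1))); first by rewrite lt_min r00 divr_gt0.
exists (K * Lam) => // x x' y; rewrite lt_min => /andP[xr0].
rewrite ltr_pdivlMr // => xr1.
have [e [einj ey _]] := enum_of_card (Hdeg x y).
have /choice[e' He'] : forall i, exists y', g x' y' = y /\ dY (e i) y' <= K * Lam * dX x x'.
  move=> i; have ei : g x (e i) = y by exact: ey.
  have [|y' gy' Hy'] := branch x x' (e i) y xr0; first by rewrite ei (mdistxx mY).
  exists y'; split=> //; apply: le_trans Hy' _.
  by rewrite ei (mdistxx mY) addr0 -mulrA ler_wpM2l.
exists e, e'; split=> // [i j eij|i|i]; [|by case: (He' i)|by case: (He' i)].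
apply: einj; apply: (inj x); last by rewrite (ey i) (ey j).
have := mdist_triangle mY (e' i) (e i) (e j); have [_ h1] := He' i; have [_] := He' j.
rewrite -eij (mdistC mY (e j)).
by have := mdist_ge0 mX x x'; lra.
Qed.

Context {Lc : R} {A : set (X * Y)} {q : nat}.
Hypothesis gY : geodesic_space dY.
Hypothesis HLc : 1 <= Lc.
Hypothesis HA1in : forall z, A z -> Lfun z <= Lc.
Hypothesis HA1out : forall z, ~ A z -> Lfun z < gamma^-1.
Hypothesis HA2 : exists (N : nat) (Ucov : nat -> set (X * Y)),
     [/\ forall i, (i < N)%N -> mopen (dprod dX dY) (Ucov i),
         forall z, exists2 i, (i < N)%N & Ucov i z,
         forall i, (i < N)%N -> injective_on (Ucov i) (skewF f g),
         exists J : seq nat, [/\ uniq J, size J = q, all (fun j => j < N)%N J &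
            forall z, A z -> exists2 j, j \in J & Ucov j z] &
         forall i, (i < N)%N -> forall (l : R) (c c1 c2 : R -> X * Y),
           min_geodesic (dprod dX dY) l c ->
           mcont_on (fun a b : R => `|a - b|) (dprod dX dY) `[0, l] c1 ->
           mcont_on (fun a b : R => `|a - b|) (dprod dX dY) `[0, l] c2 ->
           (forall t, 0 <= t <= l -> skewF f g (c1 t) = c t) ->
           (forall t, 0 <= t <= l -> skewF f g (c2 t) = c t) ->
           (exists t, 0 <= t <= l /\ Ucov i (c1 t)) ->
           (exists t, 0 <= t <= l /\ Ucov i (c2 t)) ->
           forall t, 0 <= t <= l -> c1 t = c2 t].
Hypothesis Hqd : (q < d)%N.

Lemma lift_continuous x (b : R -> Y) l K :
  (forall s t, 0 <= s -> s <= t -> t <= l -> dY (b s) (b t) <= K * (t - s)) -> 0 <= K ->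
  mcont_on (fun a b : R => `|a - b|) (dprod dX dY) `[0, l] (fun t => (x, b t)).
Proof.
move=> bK K0 s; rewrite /= in_itv /= => /andP[s0 sl] e e0.
have K1 : 0 < K + 1 by lra.
exists (e / (K + 1)); first by rewrite divr_gt0.
move=> t; rewrite /= in_itv /= => /andP[t0 tl]; rewrite ltr_pdivlMr // dprodE /= (mdistxx mX) add0r.
have [h|h] := leP s t.
  by rewrite distrC ger0_norm ?subr_ge0 // => st; have := bK s t s0 h tl; lra.
rewrite ger0_norm ?subr_ge0 ?(ltW h) // (mdistC mY) => st.
by have := bK t s t0 (ltW h) sl; lra.
Qed.

(* Lift a minimizing geodesic from [y] to [y'] through each preimage of [y]: lifts
   avoiding [A] contract by [gamma^-1], and (A2) lets at most [q] lifts meet [A]. *)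
Lemma fibre_pairing x y y' : exists e e' : 'I_d -> Y,
  exists2 B : {set 'I_d}, (#|B| <= q)%N &
  [/\ injective e, injective e', forall i, g x (e i) = y, forall i, g x (e' i) = y' &
    forall i, dY (e i) (e' i) <= (if i \in B then Lc else gamma^-1) * dY y y'].
Proof.
have [N [Ucov [_ Ucover _ [J [_ Jsize /allP JN JA]] Ugeo]]] := HA2.
have [K K0 lift] :=
  fibre_path_lift mX mY cX cY HFlip HFloc Hgamma Hdelta Hexp HLloc.
have [c [[l0 cgeo] [c0 cl]]] := gY y y'.
set l := dY y y' in l0 cgeo cl *.
have g0 : 0 < gamma by apply: lt_trans Hgamma.
have c1 s t : 0 <= s -> s <= t -> t <= l -> dY (c s) (c t) <= t - s.
  move=> s0 st tl; rewrite cgeo.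
  - by rewrite distrC ger0_norm ?subr_ge0.
  - by rewrite s0 (le_trans st).
  - by rewrite tl (le_trans s0).
have [e [einj ey _]] := enum_of_card (Hdeg x y).
have /choice[b Hb] : forall i, exists b : R -> Y, [/\ b 0 = e i,
    forall t, 0 <= t <= l -> g x (b t) = c t &
    forall s t, 0 <= s -> s <= t -> t <= l -> dY (b s) (b t) <= K * (t - s)].
  by move=> i; apply: (lift x l c (e i) l0 c1); rewrite c0; apply: ey.
(* In the product metric the curve [c] placed in the fibre over [f x] is still a minimizing
   geodesic, so (A2) applies to its lifts [b i] in the fibre over [x]. *)
have same k i j : (k < N)%N -> (exists t, 0 <= t <= l /\ Ucov k (x, b i t)) ->
    (exists t, 0 <= t <= l /\ Ucov k (x, b j t)) -> i = j.
  move=> kN Ui Uj; apply: einj.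
  have [bi0 bic biK] := Hb i; have [bj0 bjc bjK] := Hb j.
  rewrite -bi0 -bj0.
  suff [] : (x, b i 0) = (x, b j 0) by [].
  apply: (Ugeo k kN l (fun t => (f x, c t)) (fun t => (x, b i t)) (fun t => (x, b j t))) => //.
  - by split=> // s t sl tl; rewrite dprodE /= (mdistxx mX) add0r cgeo.
  - exact: lift_continuous biK K0.
  - exact: lift_continuous bjK K0.
  - by move=> t tl; rewrite /skewF /= bic.
  - by move=> t tl; rewrite /skewF /= bjc.
  - by rewrite lexx l0.
have ll : 0 <= l <= l by rewrite l0 lexx.
have meets_index i : exists j, (exists t, 0 <= t <= l /\ A (x, b i t)) ->
    j \in J /\ exists t, 0 <= t <= l /\ Ucov j (x, b i t).
  case: (pselect (exists t, 0 <= t <= l /\ A (x, b i t))) => [[t [tl At]]|nA]; last by exists 0%N.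
  by have [j jJ Uj] := JA _ At; exists j => _; split=> //; exists t.
have [ind Hind] := choice meets_index.
(* Sending a lift that meets [A] to an element of [J] that it meets is injective by [same], so [B]
   has at most [q] elements. *)
pose B := [set i : 'I_d | `[< exists t, 0 <= t <= l /\ A (x, b i t) >]]%SET.
exists e, (fun i => b i l), B.
  rewrite cardE -(size_map ind) -Jsize; apply: uniq_leq_size.
    rewrite map_inj_in_uniq ?enum_uniq // => i j.
    rewrite !mem_enum !inE => mi mj eij.
    have [iJ Ui] := Hind i mi; have [_ Uj] := Hind j mj.
    by apply: (same (ind i)) => //; [exact: JN | rewrite eij].
  by move=> k /mapP[i]; rewrite mem_enum !inE => mi ->; case: (Hind i mi).
split=> //.
(* If two lifts end at the same point, both meet the cover element containing it, and [same]
   applies. *)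
- move=> i j eij; have [k kN Uk] := Ucover (x, b i l).
  by apply: (same k) => //; exists l; rewrite // -eij.
- by move=> i; have [_ bc _] := Hb i; rewrite bc.
- move=> i; have [<- bc bK] := Hb i; rewrite inE.
  have g1 : gamma^-1 <= Lc by apply: le_trans HLc; rewrite invf_le1 // ltW.
  case: asboolP => iB.
    apply: (lift_length mX mY HLloc x l c _ K) => //; first by apply: le_trans HLc.
    move=> t tl; case: (pselect (A (x, b i t))) => [/HA1in//|/HA1out h].
    by apply: le_trans g1; exact: ltW.
  apply: (lift_length mX mY HLloc x l c _ K) => //; first by rewrite invr_ge0 ltW.
  move=> t tl; apply/ltW/HA1out => At; apply: iB; by exists t.
Qed.

Lemma fibre_pairing_sum alpha x y y' : 0 < alpha ->
  exists e e' : 'I_d -> Y,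
  [/\ injective e, injective e', forall i, g x (e i) = y, forall i, g x (e' i) = y' &
    \sum_i dY (e i) (e' i) `^ alpha <=
      ((d - q)%:R * gamma `^ (- alpha) + q%:R * Lc `^ alpha) * dY y y' `^ alpha].
Proof.
move=> a0; have [e [e' [B Bq [ei ei' ey ey' He]]]] := fibre_pairing x y y'.
exists e, e'; split=> //.
have g0 : 0 < gamma by apply: lt_trans Hgamma.
have Lc0 : 0 <= Lc by apply: le_trans HLc.
set u := gamma `^ (- alpha); set v := Lc `^ alpha.
have ul : gamma^-1 `^ alpha = u by rewrite /u -powR_inv1 ?(ltW g0) // -powRrM mulN1r.
have uv : u <= v.
  rewrite -ul; apply: ge0_ler_powR; rewrite ?nnegrE ?(ltW a0) ?invr_ge0 ?(ltW g0) //.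
  by apply: le_trans HLc; rewrite invf_le1 // ltW.
apply: (@le_trans _ _ (\sum_(i < d) (if i \in B then v else u) * dY y y' `^ alpha)).
  apply: ler_sum => i _.
  have -> : (if i \in B then v else u) = (if i \in B then Lc else gamma^-1) `^ alpha.
    by case: ifP; rewrite ?ul.
  have c0 : 0 <= (if i \in B then Lc else gamma^-1) by case: ifP; rewrite // invr_ge0 ltW.
  rewrite -powRM ?(mdist_ge0 mY) //.
  by apply: ge0_ler_powR (He i); rewrite ?nnegrE ?mulr_ge0 ?(mdist_ge0 mY) ?(ltW a0).
rewrite -mulr_suml ler_wpM2r ?powR_ge0 //.
rewrite (bigID (fun i => i \in B)) /=.
rewrite (eq_bigr (fun=> v)); last by move=> i ->.
rewrite [X in _ + X](eq_bigr (fun=> u)); last by move=> i /negbTE ->.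
rewrite !sumr_const -[v *+ _]mulr_natl -[u *+ _]mulr_natl.
have cB : (#|B| + #|[predC B]| = d)%N by rewrite (cardC (mem B)) card_ord.
have -> : #|[predC B]| = (d - #|B|)%N by rewrite -[LHS](addKn #|B|) cB.
have Bd : (#|B| <= d)%N by have := max_card (mem B); rewrite card_ord.
rewrite !natrB ?(ltnW Hqd) //.
(* Since [u <= v], the sum is largest when [B] has exactly [q] elements. *)
have : (q%:R - #|B|%:R) * u <= (q%:R - #|B|%:R) * v.
  by apply: ler_wpM2l => //; rewrite subr_ge0 ler_nat.
by lra.
Qed.

End Pairings.

(** * Transfer operators on Holder cones *)

(* Nonnegative functions whose [alpha]-Holder seminorm is at most [k] times their infimum. *)
Definition holder_cone {Y : Type} (dY : Y -> Y -> R) (alpha k : R) (psi : Y -> R) : Prop :=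
  (forall y, 0 <= psi y) /\
  forall y y' y'', `|psi y - psi y'| <= k * psi y'' * dY y y' `^ alpha.

Section Cone.
Context {Y : pointedType} {dY : Y -> Y -> R} {alpha D : R}.
Hypothesis HD : forall y y', dY y y' `^ alpha <= D.
Local Notation cone := (holder_cone dY alpha).

Lemma holder_cone_harnack k psi y y' : 0 <= k -> cone k psi -> psi y <= (1 + k * D) * psi y'.
Proof.
move=> k0 [p0 pH]; have := pH y y' y'; have := HD y y'; have := ler_norm (psi y - psi y').
have : k * psi y' * dY y y' `^ alpha <= k * psi y' * D by rewrite ler_wpM2l ?mulr_ge0.
by lra.
Qed.

Lemma holder_cone_le k k' psi : k <= k' -> cone k psi -> cone k' psi.
Proof.
move=> kk' [p0 pH]; split=> // y y' y''; apply: le_trans (pH y y' y'') _.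
by rewrite !ler_wpM2r ?powR_ge0.
Qed.

Lemma holder_cone1 k : 0 <= k -> cone k (fun=> 1).
Proof. by move=> k0; split=> // y y' y''; rewrite subrr normr0 mulr1 mulr_ge0 ?powR_ge0. Qed.

(** The oscillation of [u - c w] is controlled by [k1 (u + c w)], and the last hypothesis is a
    rearrangement of [k1 (u + c w) <= k (u - c w)]. *)
Lemma holder_cone_sub k k1 c u w : 0 <= k1 -> k1 < k -> 0 <= c ->
  cone k1 u -> cone k1 w -> (forall y, c * (k + k1) * w y <= (k - k1) * u y) ->
  cone k (fun y => u y - c * w y).
Proof.
move=> k10 kk1 c0 [u0 uH] [w0 wH] uw; split=> [y|y y' y''].
  have cw : 0 <= c * k1 * w y by rewrite !mulr_ge0.
  have h : 0 <= (k - k1) * (u y - c * w y) by have := uw y; lra.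
  by rewrite pmulr_rge0 ?subr_gt0 in h.
set dd := dY y y' `^ alpha; have d0 : 0 <= dd by exact: powR_ge0.
have := uH y y' y''; have := wH y y' y''; rewrite -/dd => h1 h2.
have h3 : c * `|w y - w y'| <= c * (k1 * w y'' * dd) by rewrite ler_wpM2l.
have h4 : c * (k + k1) * w y'' * dd <= (k - k1) * u y'' * dd by rewrite ler_wpM2r.
have -> : u y - c * w y - (u y' - c * w y') = (u y - u y') - c * (w y - w y') by ring.
apply: le_trans (ler_normB _ _) _; rewrite normrM (ger0_norm c0).
by lra.
Qed.

(** At [point] one of [u] and [v] is at least half of [t w]. The Harnack inequality carries this
    comparison to all of [Y], and that function can afford the subtraction. *)
Lemma holder_cone_split k k1 t u v w : 0 <= k1 -> k1 < k -> 0 <= t ->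
  cone k1 u -> cone k1 v -> cone k1 w -> (forall y, u y + v y = t * w y) ->
  let eta := (k - k1) / (2 * (k + k1) * (1 + k1 * D) ^+ 2) in
  cone k (fun y => u y - eta * t * w y) \/ cone k (fun y => v y - eta * t * w y).
Proof.
move=> k10 kk1 t0 uC vC wC uvw eta.
have D0 : 0 <= D by apply: le_trans (powR_ge0 _ _) (HD point point).
set H := 1 + k1 * D in eta *.
have H0 : 0 < H by rewrite ltr_pwDl // mulr_ge0.
have k0 : 0 < k + k1 by lra.
have eta0 : 0 <= eta by rewrite /eta divr_ge0 ?mulr_ge0 ?exprn_ge0 ?subr_ge0 // ltW.
have etaE : eta * (k + k1) * H = (k - k1) / (2 * H).
  by rewrite /eta; field; rewrite !gt_eqF.
clearbody eta.
(* Harnack is used once for [w] and once for [z], hence the square in [eta]; its factor 2 pays for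
   the half. *)
have half z : cone k1 z -> t * w point <= 2 * z point -> cone k (fun y => z y - eta * t * w y).
  move=> zC zt; apply: (holder_cone_sub k k1) => //; first by rewrite mulr_ge0.
  move=> y.
  have h1 := holder_cone_harnack k1 w y point k10 wC.
  have h2 := holder_cone_harnack k1 z point y k10 zC.
  rewrite -/H in h1 h2.
  have h3 : eta * t * (k + k1) * w y <= eta * t * (k + k1) * (H * w point).
    by rewrite ler_wpM2l ?mulr_ge0 // ltW.
  apply: le_trans h3 _.
  have -> : eta * t * (k + k1) * (H * w point) = eta * (k + k1) * H * (t * w point) by ring.
  rewrite etaE -mulrA; apply: ler_wpM2l; first by lra.
  by rewrite mulrC ler_pdivrMr ?mulr_gt0 //; lra.
have := uvw point; have [h|h] := leP (t * w point) (2 * u point).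
  by left; apply: half.
by move=> e; right; apply: half => //; lra.
Qed.

End Cone.

(** * Cone contraction by the fibre operators *)

Section Transfer.
Context {X Y : pointedType} {dY : Y -> Y -> R} {f : X -> X} {g : X -> Y -> Y} {d : nat}.
Context {phi : X * Y -> R}.
Hypothesis Hdeg : forall x y, (g x @^-1` [set y] #= `I_d)%card.
Local Notation L := (Lop g phi).

(** An injective family of [d] preimages exhausts the fibre: expressed in a complete enumeration it
    is an injective self-map of a finite set. The operator may therefore be summed along whichever
    pairing is convenient. *)
Lemma LopE x psi y (e : 'I_d -> Y) : injective e -> (forall i, g x (e i) = y) ->
  L x psi y = \sum_i expR (phi (x, e i)) * psi (e i).
Proof.
move=> einj ey; have [e0 [e0inj e0y e0s]] := enum_of_card (Hdeg x y).
have /choice[s Hs] : forall i, exists j, e0 j = e i by move=> i; apply/e0s/ey.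
have sinj : injective s by move=> i j sij; apply: einj; rewrite -!Hs sij.
have -> : \sum_i expR (phi (x, e i)) * psi (e i) =
    \sum_(z <- [seq e i | i <- enum 'I_d]) expR (phi (x, z)) * psi z.
  by rewrite big_map big_enum.
rewrite fsbig_seq; last by rewrite map_inj_uniq ?enum_uniq.
apply: eq_fsbigl; apply/seteqP; split=> [z gz|z /= /mapP[i _ ->]]; last exact: ey.
have [j <-] := e0s z gz; have [s' _ ss'] := injF_bij sinj.
by rewrite /= -(ss' j) Hs; apply: map_f; rewrite mem_enum.
Qed.

Lemma Lop_enum x y : exists2 e : 'I_d -> Y, injective e & (forall i, g x (e i) = y).
Proof. by have [e [einj ey _]] := enum_of_card (Hdeg x y); exists e. Qed.

Lemma Lop_ge0 x psi : (forall y, 0 <= psi y) -> forall y, 0 <= L x psi y.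
Proof.
move=> p0 y; have [e einj ey] := Lop_enum x y; rewrite (LopE _ _ _ e) //.
by apply: sumr_ge0 => i _; rewrite mulr_ge0 ?expR_ge0.
Qed.

Lemma Lop_subZ x psi chi a : L x (fun y => psi y - a * chi y) =
  (fun y => L x psi y - a * L x chi y).
Proof.
apply/funext => y; have [e einj ey] := Lop_enum x y; rewrite !(LopE _ _ _ e) //.
by rewrite mulr_sumr -sumrB; apply: eq_bigr => i _; ring.
Qed.

Lemma Lop_Zsub x psi chi a : L x (fun y => a * chi y - psi y) =
  (fun y => a * L x chi y - L x psi y).
Proof.
apply/funext => y; have [e einj ey] := Lop_enum x y; rewrite !(LopE _ _ _ e) //.
by rewrite mulr_sumr -sumrB; apply: eq_bigr => i _; ring.
Qed.

(** The recursion of [Lopn] exposes the last operator; exposing the first one puts numerator and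
    denominator of the ratio under the same operator, applied to [L x 1] and to [1]. *)
Lemma LopnSr n x psi : Lopn f g phi n.+1 x psi = Lopn f g phi n (f x) (L x psi).
Proof. by elim: n => //= n <-; rewrite -iterSr. Qed.

Context {alpha N m eps D : R}.
Hypothesis d0 : (0 < d)%N.
Hypothesis Hpair : forall x y y', exists e e' : 'I_d -> Y,
  [/\ injective e, injective e', forall i, g x (e i) = y, forall i, g x (e' i) = y' &
    \sum_i dY (e i) (e' i) `^ alpha <= N * dY y y' `^ alpha].
Hypothesis HD : forall y y', dY y y' `^ alpha <= D.
Hypothesis eps0 : 0 < eps.
Hypotheses (phi_ge : forall z, m <= phi z) (phi_le : forall z, phi z <= m + eps).
Hypothesis phi_holder : forall x y y', `|expR (phi (x, y)) - expR (phi (x, y'))| <=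
  eps * expR m * dY y y' `^ alpha.
Hypothesis N0 : 0 <= N.
Local Notation cone := (holder_cone dY alpha).
Let s := expR eps * N / d%:R.

(** A Lasota-Yorke type estimate: along paired preimages, the variation of [psi] contributes [k],
    and that of the weight contributes [eps] times the Harnack factor. *)
Lemma Lop_holder_cone k x psi : 0 <= k ->
  cone k psi -> cone (s * (k + eps * (1 + k * D))) (L x psi).
Proof.
move=> k0 pC; have [p0 pH] := pC; split=> [|y1 y2 y3].
  exact: Lop_ge0.
have D0 : 0 <= D by apply: le_trans (powR_ge0 _ _) (HD point point).
have [e [e' [ei e'i ey e'y Hsum]]] := Hpair x y1 y2.
have [e3 e3i e3y] := Lop_enum x y3.
(* The third point of the cone condition is the preimage of [y3] where [psi] is smallest, since
   [L x psi y3] is at least [d * expR m] times that value. *)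
pose i0 := [arg min_(i < Ordinal d0) psi (e3 i)]%O.
have min0 i : psi (e3 i0) <= psi (e3 i) by rewrite /i0; case: arg_minP => // j _; apply.
set p := psi (e3 i0) in min0; have pp : 0 <= p by exact: p0.
have L3 : d%:R * (expR m * p) <= L x psi y3.
  rewrite (LopE _ _ _ e3) // mulr_natl -[X in _ *+ X](card_ord d) -sumr_const.
  by apply: ler_sum => i _; apply: ler_pM; rewrite ?expR_ge0 ?ler_expR.
rewrite (LopE _ _ _ e) // (LopE _ _ _ e') // -sumrB.
apply: le_trans (ler_norm_sum _ _ _) _.
set C := expR eps * (k + eps * (1 + k * D)).
apply: (@le_trans _ _ (\sum_(i < d) C * (expR m * p) * dY (e i) (e' i) `^ alpha)).
  apply: ler_sum => i _; set dd := dY (e i) (e' i) `^ alpha.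
  have dd0 : 0 <= dd by exact: powR_ge0.
  set E := expR _; set E' := expR _.
  have -> : E * psi (e i) - E' * psi (e' i) =
     E * (psi (e i) - psi (e' i)) + psi (e' i) * (E - E') by ring.
  apply: le_trans (ler_normD _ _) _; rewrite !normrM (ger0_norm (p0 _)) ger0_norm ?expR_ge0 //.
  have h1 : E * `|psi (e i) - psi (e' i)| <= expR m * expR eps * (k * p * dd).
    by apply: ler_pM; rewrite ?expR_ge0 //; [rewrite -exp.expRD ler_expR | exact: pH].
  have h2 : psi (e' i) * `|E - E'| <= (1 + k * D) * p * (eps * expR m * dd).
    by apply: ler_pM => //; [exact: holder_cone_harnack | exact: phi_holder].
  apply: le_trans (lerD h1 h2) _.
  (* Enlarging the weight term by [expR eps >= 1] gives both terms the common constant [C]. *)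
  have h3 : 1 * ((1 + k * D) * p * (eps * expR m * dd)) <=
      expR eps * ((1 + k * D) * p * (eps * expR m * dd)).
    apply: ler_wpM2r; last by rewrite -exp.expR0 ler_expR ltW.
    by rewrite !mulr_ge0 ?expR_ge0 ?addr_ge0 ?mulr_ge0 // ltW.
  by rewrite /C; lra.
rewrite -mulr_sumr.
have C0 : 0 <= C by rewrite mulr_ge0 ?expR_ge0 ?addr_ge0 ?mulr_ge0 ?addr_ge0 ?mulr_ge0 // ltW.
have dR : 0 < d%:R :> R by rewrite ltr0n.
have mp : expR m * p <= L x psi y3 / d%:R by rewrite ler_pdivlMr // mulrC.
apply: (@le_trans _ _ (C * (L x psi y3 / d%:R) * (N * dY y1 y2 `^ alpha))).
  apply: ler_pM => //; first by rewrite mulr_ge0 // mulr_ge0 ?expR_ge0.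
    by apply: sumr_ge0 => i _; exact: powR_ge0.
  by rewrite ler_wpM2l.
by rewrite /C /s le_eqVlt; apply/orP; left; apply/eqP; field; rewrite gt_eqF.
Qed.

Lemma Lopn1_gt0 n x y : 0 < Lopn f g phi n x (fun=> 1) y.
Proof.
elim: n y => //= n IH y; have [e einj ey] := Lop_enum (iter n f x) y; rewrite (LopE _ _ _ e) //.
rewrite (bigD1 (Ordinal d0)) //= ltr_pwDl ?mulr_gt0 ?expR_gt0 //.
by apply: sumr_ge0 => i _; rewrite mulr_ge0 ?expR_ge0 // ltW.
Qed.

Hypothesis Hs : s + 2 * s * eps * D < 1.

Lemma contracted_cone_exists : exists k k1, [/\ 0 <= k1, k1 < k &
  forall x psi, cone k psi -> cone k1 (L x psi)].
Proof.
have D0 : 0 <= D by apply: le_trans (powR_ge0 _ _) (HD point point).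
have s0 : 0 <= s by rewrite /s divr_ge0 ?mulr_ge0 ?expR_ge0.
have se0 : 0 <= s * eps by rewrite mulr_ge0 // ltW.
have seD0 : 0 <= s * eps * D by rewrite mulr_ge0.
pose th := s + s * eps * D.
have th1 : 0 < 1 - th by have := Hs; rewrite /th; lra.
(* The cone constant evolves by an affine map of slope [th < 1]; [k] lies one above its fixed point,
   so its image [k1] is strictly smaller. *)
pose k := s * eps / (1 - th) + 1.
have k0 : 0 <= k by rewrite addr_ge0 // divr_ge0 // ltW.
have kE : k * (1 - th) = s * eps + (1 - th) by rewrite /k; field; rewrite gt_eqF.
exists k, (s * (k + eps * (1 + k * D))); split.
- by rewrite mulr_ge0 // addr_ge0 // mulr_ge0 ?(ltW eps0) // addr_ge0 ?mulr_ge0.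
- move: kE th1; rewrite /th => kE th1.
  have -> : s * (k + eps * (1 + k * D)) = k - (k * (1 - (s + s * eps * D)) - s * eps) by ring.
  by rewrite kE; lra.
- by move=> x psi; apply: Lop_holder_cone.
Qed.

Context {k k1 : R}.
Hypotheses (k10 : 0 <= k1) (kk1 : k1 < k).
Hypothesis Lcone : forall x psi, cone k psi -> cone k1 (L x psi).
Let k0 : 0 <= k := le_trans k10 (ltW kk1).
Let eta := (k - k1) / (2 * (k + k1) * (1 + k1 * D) ^+ 2).
Local Notation Ln := (Lopn f g phi).

Lemma Lopn_cone n x psi : cone k psi -> cone k (Ln n x psi).
Proof.
move=> pC; elim: n => //= n IH.
exact: holder_cone_le (ltW kk1) (Lcone _ _ IH).
Qed.

Lemma gap_ratio_bounds : 0 < eta <= 1.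
Proof.
have D0 : 0 <= D by apply: le_trans (powR_ge0 _ _) (HD point point).
have kk : 0 < k + k1 by have := k10; have := kk1; lra.
have H1 : 1 <= (1 + k1 * D) ^+ 2.
  by rewrite exprn_ege1 // lerDl mulr_ge0.
have H0 : 0 < 2 * (k + k1) * (1 + k1 * D) ^+ 2.
  by apply: mulr_gt0; [apply: mulr_gt0|apply: lt_le_trans H1].
rewrite /eta divr_gt0 ?subr_gt0 //= ler_pdivrMr // mul1r.
have : 2 * (k + k1) * 1 <= 2 * (k + k1) * (1 + k1 * D) ^+ 2.
  by rewrite ler_wpM2l // mulr_ge0 // ltW.
by have := k10; have := kk1; lra.
Qed.

(** The images of [psi - a chi] and [b chi - psi] add up to [(b - a) L chi]. Splitting therefore
    either raises [a] or lowers [b] by [eta * (b - a)]. *)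
Lemma gap_step x psi chi a b : cone k chi -> a <= b ->
  cone k (fun y => psi y - a * chi y) -> cone k (fun y => b * chi y - psi y) ->
  exists a' b', [/\ a <= a', a' <= b', b' <= b, b' - a' = (1 - eta) * (b - a) &
    cone k (fun y => L x psi y - a' * L x chi y) /\
    cone k (fun y => b' * L x chi y - L x psi y)].
Proof.
move=> cC ab aC bC.
have uC := Lcone x _ aC; have vC := Lcone x _ bC; have wC := Lcone x _ cC.
rewrite Lop_subZ in uC; rewrite Lop_Zsub in vC.
have [e0 e1] := andP gap_ratio_bounds.
have t0 : 0 <= b - a by rewrite subr_ge0.
have et0 : 0 <= eta * (b - a) by rewrite mulr_ge0 // ltW.
have et1 : eta * (b - a) <= b - a by rewrite ler_piMl.
have [|H|H] := holder_cone_split HD k k1 (b - a) _ _ _ k10 kk1 t0 uC vC wC.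
- by move=> y; ring.
- exists (a + eta * (b - a)), b; split; [lra|lra|lra|ring|split].
    by rewrite -/eta in H; congr (cone k _): H; apply/funext => y; ring.
  exact: holder_cone_le (ltW kk1) vC.
- exists a, (b - eta * (b - a)); split; [lra|lra|lra|ring|split].
    exact: holder_cone_le (ltW kk1) uC.
  by rewrite -/eta in H; congr (cone k _): H; apply/funext => y; ring.
Qed.

Lemma gap_iter n x psi chi a b : cone k chi -> a <= b ->
  cone k (fun y => psi y - a * chi y) -> cone k (fun y => b * chi y - psi y) ->
  exists a' b', [/\ a <= a', a' <= b', b' <= b, b' - a' = (1 - eta) ^+ n * (b - a) &
    cone k (fun y => Ln n x psi y - a' * Ln n x chi y) /\
    cone k (fun y => b' * Ln n x chi y - Ln n x psi y)].
Proof.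
move=> cC ab aC bC; elim: n => [|n [a1 [b1 [aa1 ab1 bb1 gap [aC1 bC1]]]]].
  by exists a, b; split=> //; rewrite expr0 mul1r.
have [a2 [b2 [aa2 ab2 bb2 gap2 [aC2 bC2]]]] :=
  gap_step (iter n f x) _ _ _ _ (Lopn_cone n x _ cC) ab1 aC1 bC1.
exists a2, b2; split=> //; [exact: le_trans aa2|exact: le_trans bb1|].
by rewrite gap2 gap exprS mulrA.
Qed.

Lemma Lop1_bounds x y : d%:R * expR m <= L x (fun=> 1) y <= d%:R * (expR m * expR eps).
Proof.
have [e einj ey] := Lop_enum x y; rewrite (LopE _ _ _ e) //.
have sumc (c : R) : d%:R * c = \sum_(i < d) c by rewrite sumr_const card_ord mulr_natl.
rewrite !sumc.
by apply/andP; split; apply: ler_sum => i _; rewrite mulr1 -?exp.expRD ler_expR.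
Qed.

Lemma Lopn_ratio_bounds : exists a0 b0 tau, [/\ 0 < a0, 0 < b0, 0 < tau, tau < 1 &
  forall x n, exists a b, [/\ a0 <= a, a <= b, b <= b0, b - a <= b0 * tau ^+ n &
    forall j y, (n <= j)%N ->
      a * Ln j (f x) (fun=> 1) y <= Ln j.+1 x (fun=> 1) y <= b * Ln j (f x) (fun=> 1) y]].
Proof.
have dR : 0 < d%:R :> R by rewrite ltr0n.
have M0 : 0 < d%:R * expR m :> R by rewrite mulr_gt0 // expR_gt0.
have E1 : 1 <= expR eps by rewrite -exp.expR0 ler_expR ltW.
have kp : 0 < k by apply: le_lt_trans k10 kk1.
have kkp : 0 < k + k1 by rewrite ltr_wpDr.
(* The initial bounds: [a0] is the largest constant that [holder_cone_sub] can subtract given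
   [L 1 >= d * expR m]; [b0] is twice the upper bound of [L 1], so that [b0 - L 1 >= L 1] inherits
   the cone condition. *)
pose a0 := (k - k1) * (d%:R * expR m) / (k + k1).
pose b0 := 2 * (d%:R * (expR m * expR eps)).
have a00 : 0 < a0 by rewrite /a0 divr_gt0 // mulr_gt0 // subr_gt0.
have a0E : a0 * (k + k1) = (k - k1) * (d%:R * expR m) by rewrite /a0 divfK // gt_eqF.
have ab0 : a0 <= b0.
  apply: (@le_trans _ _ (d%:R * expR m)).
    by rewrite /a0 ler_pdivrMr // [X in _ <= X]mulrC ler_wpM2r ?(ltW M0) //; have := k10; lra.
  have : d%:R * expR m * 1 <= d%:R * expR m * expR eps by rewrite ler_wpM2l // ltW.
  by rewrite /b0; lra.
have b00 : 0 < b0 by apply: lt_le_trans ab0.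
have [e0 e1] := andP gap_ratio_bounds.
have cone_one : cone k (fun=> 1) by exact: holder_cone1.
have Lb x y := andP (Lop1_bounds x y).
have LC x : cone k1 (L x (fun=> 1)) by exact: Lcone.
have aC x : cone k (fun y => L x (fun=> 1) y - a0 * 1).
  apply: (holder_cone_sub k k1) => //; [exact: ltW|exact: holder_cone1|].
  move=> y; rewrite mulr1 a0E ler_wpM2l ?subr_ge0 ?(ltW kk1) //.
  by case: (Lb x y).
have bC x : cone k (fun y => b0 * 1 - L x (fun=> 1) y).
  have bL y : L x (fun=> 1) y <= b0 - L x (fun=> 1) y by case: (Lb x y); rewrite /b0; lra.
  have [L0 LH] := LC x; split=> [y|y y' y'']; first by rewrite mulr1; apply: le_trans (bL y).
  rewrite mulr1; have -> : b0 - L x (fun=> 1) y - (b0 - L x (fun=> 1) y') =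
    - (L x (fun=> 1) y - L x (fun=> 1) y') by ring.
  rewrite normrN; apply: le_trans (LH y y' y'') _.
  by rewrite ler_wpM2r ?powR_ge0 // ler_pM // ltW.
(* The rate [1 - eta] could vanish, as only [eta <= 1] is known; [1 - eta / 2] stays positive. *)
exists a0, b0, (1 - eta / 2); split=> //; [lra|lra|] => x n.
have [a [b [aa ab bb gap [aC' bC']]]] := gap_iter n (f x) _ _ _ _ cone_one ab0 (aC x) (bC x).
exists a, b; split=> //.
  rewrite gap mulrC; apply: ler_pM => //; [lra|by rewrite exprn_ge0 //; lra|lra|].
  by apply: lerXn2r; rewrite ?nnegrE; lra.
have base y : a * Ln n (f x) (fun=> 1) y <= Ln n.+1 x (fun=> 1) y <= b * Ln n (f x) (fun=> 1) y.
  have h1 : 0 <= Ln n (f x) (L x (fun=> 1)) y - a * Ln n (f x) (fun=> 1) y by case: aC'.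
  have h2 : 0 <= b * Ln n (f x) (fun=> 1) y - Ln n (f x) (L x (fun=> 1)) y by case: bC'.
  by rewrite LopnSr -subr_ge0 h1 -subr_ge0.
(* Positivity and linearity of the operators propagate the two inequalities from [n] to every later
   [j]. *)
elim=> [|j IH] y; first by rewrite leqn0 => /eqP n0; subst n.
rewrite leq_eqVlt => /orP[/eqP n0|nj]; first by subst n.
have {}IH := IH ^~ nj.
have h1 : forall y, 0 <= Ln j.+1 x (fun=> 1) y - a * Ln j (f x) (fun=> 1) y.
  by move=> z; case/andP: (IH z); rewrite subr_ge0.
have h2 : forall y, 0 <= b * Ln j (f x) (fun=> 1) y - Ln j.+1 x (fun=> 1) y.
  by move=> z; case/andP: (IH z); rewrite subr_ge0.
have := Lop_ge0 (iter j.+1 f x) _ h1 y; have := Lop_ge0 (iter j.+1 f x) _ h2 y.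
rewrite Lop_subZ Lop_Zsub !subr_ge0 => h3 h4.
have fE : L (iter j.+1 f x) (Ln j (f x) (fun=> 1)) = Ln j.+1 (f x) (fun=> 1) by rewrite /= -iterSr.
by rewrite fE in h3 h4; apply/andP.
Qed.

End Transfer.

(** * Dependence on the base point *)

Section NearbyFibres.
Context {X Y : pointedType} {dX : X -> X -> R} {dY : Y -> Y -> R} {f : X -> X}.
Context {g : X -> Y -> Y} {d : nat} {phi : X * Y -> R} {alpha k Lam r K H : R}.
Hypothesis Hdeg : forall x y, (g x @^-1` [set y] #= `I_d)%card.
Hypotheses (mX : is_metric dX) (mY : is_metric dY).
Hypotheses (a0 : 0 < alpha) (k0 : 0 <= k) (Lam1 : 1 < Lam) (K0 : 0 <= K) (H0 : 0 <= H).
Hypothesis f_lip : forall x x', dX (f x) (f x') <= Lam * dX x x'.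
Hypothesis near : forall x x' y, dX x x' < r -> exists e e' : 'I_d -> Y,
    [/\ injective e, injective e', forall i, g x (e i) = y, forall i, g x' (e' i) = y &
      forall i, dY (e i) (e' i) <= K * dX x x'].
Hypothesis phiH : forall z z', `|phi z - phi z'| <= H * dprod dX dY z z' `^ alpha.
Hypothesis cone_one : forall n x, holder_cone dY alpha k (Lopn f g phi n x (fun=> 1)).

Lemma iter_lipschitz n x x' : dX (iter n f x) (iter n f x') <= Lam ^+ n * dX x x'.
Proof.
elim: n => [|n IH]; first by rewrite expr0 mul1r.
apply: le_trans (f_lip _ _) _; rewrite exprS -mulrA ler_wpM2l //.
exact: le_trans (ltW Lam1).
Qed.

(** Induction on [n], pairing the preimages of [y] over the two [n]-th iterates: the Holder
    potential compares the weights, the cone condition moves the function from [e i] to [e' i], and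
    the induction hypothesis changes the base point. *)
Lemma Lopn_nearby : exists2 c, 0 <= c & forall n x x', Lam ^+ n * dX x x' < r ->
  forall y, Lopn f g phi n x (fun=> 1) y <=
    expR (c * (Lam ^+ n * dX x x') `^ alpha) * Lopn f g phi n x' (fun=> 1) y.
Proof.
have La1 : 1 < Lam `^ alpha.
  have <- : 1 `^ alpha = 1 by rewrite powR1.
  by apply: gt0_ltr_powR; rewrite ?nnegrE // ltW // (lt_trans ltr01).
pose c1 := H * (1 + K) `^ alpha + k * K `^ alpha.
have c10 : 0 <= c1 by rewrite addr_ge0 // mulr_ge0 ?powR_ge0.
(* [c] solves [c * Lam ^ alpha = c + c1]: rescaling the distance by [Lam] absorbs the cost [c1] of
   one more step. *)
pose c := c1 / (Lam `^ alpha - 1).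
have cE : c * Lam `^ alpha = c + c1 by rewrite /c; field; rewrite subr_eq0 gt_eqF.
have c0 : 0 <= c by rewrite /c divr_ge0 // subr_ge0 ltW.
have L0 : 0 <= Lam by apply: le_trans (ltW Lam1).
exists c => //; elim=> [|n IH] x x' small y.
  by rewrite mulr1 -[X in X <= _]exp.expR0 ler_expR mulr_ge0 ?powR_ge0.
set t := Lam ^+ n * dX x x'.
have t0 : 0 <= t by rewrite mulr_ge0 ?exprn_ge0 ?(mdist_ge0 mX).
have St : Lam ^+ n.+1 * dX x x' = Lam * t by rewrite exprS mulrA.
have tr : t < r.
  by apply: le_lt_trans small; rewrite St -[X in X <= _]mul1r ler_wpM2r // ltW.
have {}IH := IH x x' tr; rewrite -/t in IH.
have dt : dX (iter n f x) (iter n f x') <= t by exact: iter_lipschitz.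
have [e [e' [ei e'i ey e'y He]]] := near _ _ y (le_lt_trans dt tr).
rewrite /= (LopE Hdeg _ _ _ e) // (LopE Hdeg _ _ _ e') // mulr_sumr.
apply: ler_sum => i _.
have dY_le : dY (e i) (e' i) <= K * t by apply: le_trans (He i) _; rewrite ler_wpM2l.
rewrite St powRM //; set ta := t `^ alpha.
have -> : c * (Lam `^ alpha * ta) = (c + c1) * ta by rewrite mulrA cE.
have h1 : expR (phi (iter n f x, e i)) <=
    expR (H * (1 + K) `^ alpha * ta) * expR (phi (iter n f x', e' i)).
  rewrite -exp.expRD ler_expR.
  have : dprod dX dY (iter n f x, e i) (iter n f x', e' i) <= (1 + K) * t.
    by rewrite dprodE /=; lra.
  move=> /(ge0_ler_powR (ltW a0)).
  rewrite !nnegrE (mdist_ge0 (dprod_metric mX mY)) mulr_ge0 ?addr_ge0 // powRM ?addr_ge0 //.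
  move=> /(_ isT isT) => /(ler_wpM2l H0).
  have := phiH (iter n f x, e i) (iter n f x', e' i).
  have := ler_norm (phi (iter n f x, e i) - phi (iter n f x', e' i)).
  by rewrite -/ta; lra.
have [p0 pH] := cone_one n x; have [p0' _] := cone_one n x'.
have h2 : Lopn f g phi n x (fun=> 1) (e i) <=
    expR (k * K `^ alpha * ta) * Lopn f g phi n x (fun=> 1) (e' i).
  have := pH (e i) (e' i) (e' i).
  have := ler_norm (Lopn f g phi n x (fun=> 1) (e i) - Lopn f g phi n x (fun=> 1) (e' i)).
  have h3 : dY (e i) (e' i) `^ alpha <= K `^ alpha * ta.
    rewrite -powRM //; apply: ge0_ler_powR (dY_le); rewrite ?nnegrE ?(ltW a0) ?(mdist_ge0 mY) //.
    exact: mulr_ge0.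
  have h4 := expR_ge1Dx (k * K `^ alpha * ta).
  have h5 : (1 + k * K `^ alpha * ta) * Lopn f g phi n x (fun=> 1) (e' i) <=
    expR (k * K `^ alpha * ta) * Lopn f g phi n x (fun=> 1) (e' i) by rewrite ler_wpM2r.
  have h6 : k * Lopn f g phi n x (fun=> 1) (e' i) * dY (e i) (e' i) `^ alpha <=
    k * Lopn f g phi n x (fun=> 1) (e' i) * (K `^ alpha * ta) by rewrite ler_wpM2l ?mulr_ge0.
  by lra.
have h3 : Lopn f g phi n x (fun=> 1) (e i) <= expR (k * K `^ alpha * ta) *
    (expR (c * ta) * Lopn f g phi n x' (fun=> 1) (e' i)).
  by apply: le_trans h2 _; rewrite ler_wpM2l ?expR_ge0 // IH.
have -> : (c + c1) * ta = H * (1 + K) `^ alpha * ta + (k * K `^ alpha * ta + c * ta).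
  by rewrite /c1; ring.
rewrite !exp.expRD; apply: le_trans (ler_pM _ _ h1 h3) _; rewrite ?expR_ge0 //.
by rewrite le_eqVlt; apply/orP; left; apply/eqP; ring.
Qed.

End NearbyFibres.

(** * Interpolation to a Holder estimate *)

Lemma powR_exprn_comm (x a : R) n : 0 <= x -> (x ^+ n) `^ a = (x `^ a) ^+ n.
Proof. by move=> x0; rewrite -(powR_mulrn n x0) -(powR_mulrn n (powR_ge0 x a)) powRAC. Qed.

(* Interpolation: the Holder constants of [Phi_ n] may grow exponentially, since they
   compete with an exponentially small error; take [n] comparable to [- ln (d x x')]. *)
Lemma holder_of_exponential_approx {T : Type} {d : T -> T -> R} (Phi : T -> R)
    (Phi_ : nat -> T -> R) (C tau Lam alpha r B : R) : is_metric d ->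
  0 <= C -> 0 < tau < 1 -> 2 <= Lam -> 0 < alpha -> 0 < r ->
  (forall x, `|Phi x| <= B) ->
  (forall n x, `|Phi x - Phi_ n x| <= C * tau ^+ n) ->
  (forall n x x', Lam ^+ n.+1 * d x x' < r ->
     `|Phi_ n x - Phi_ n x'| <= C * (Lam ^+ n.+1 * d x x') `^ alpha) ->
  holder_continuous d Phi.
Proof.
move=> dM C0 /andP[tau0 tau1] Lam2 al0 r0 PhiB approx local.
have Lam0 : 0 <= Lam by lra.
pose M := Lam ^+ 2; have M4 : 4 <= M.
  by rewrite /M expr2; apply: (@le_trans _ _ (2 * 2)); [lra|apply: ler_pM].
have M0 : 0 <= M by lra.
have lnM : 0 < ln M by apply: ln_gt0; lra.
have lntau : 0 < ln tau^-1 by apply: ln_gt0; rewrite invf_gt1.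
(* With [M = Lam ^ 2], a distance [D] of order [M ^ -n] makes [Lam ^ n * D] of order [sqrt D], hence
   [alpha / 2]. The other bound gives [M ^ a <= tau^-1], so that [tau ^ n] is at most of order
   [D ^ a]. *)
pose a := Num.min (alpha / 2) (ln tau^-1 / ln M).
have a0 : 0 < a by rewrite lt_min !divr_gt0.
have a_al : a <= alpha / 2 by rewrite ge_min lexx.
have Ma : M `^ a <= tau^-1.
  apply: (@le_trans _ _ (M `^ (ln tau^-1 / ln M))).
    by apply: ler_powR; [lra|rewrite ge_min lexx orbT].
  by rewrite /powR gt_eqF ?divfK ?gt_eqF ?lnK ?posrE ?invr_gt0 //; lra.
have one_a : 1 `^ a = 1 by rewrite powR1.
pose r1 := Num.min (r / 2) 1.
have r10 : 0 < r1 by rewrite lt_min divr_gt0 //=.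
have r1r : r1 < r by rewrite gt_min; apply/orP; left; lra.
have r11 : r1 <= 1 by rewrite ge_min lexx orbT.
pose q := (M ^+ 2 / r1) `^ a.
have Mr0 : 0 <= M ^+ 2 / r1 by rewrite divr_ge0 ?exprn_ge0 // ltW.
have q0 : 0 <= q by exact: powR_ge0.
(* The three terms pay for the two approximation errors, the local estimate, and points that are far
   apart. *)
exists a; split=> //; exists (2 * C * q + C + 2 * B * q) => x x'.
set D := d x x'; have D0 : 0 <= D by exact: mdist_ge0.
have Da0 : 0 <= D `^ a by exact: powR_ge0.
have B00 : 0 <= B by apply: le_trans (PhiB x).
have [D00|Dn0] := eqVneq D 0.
  have := mdist_eq0 dM _ _ D00 => <-.
  by rewrite subrr normr0 mulr_ge0 // !addr_ge0 // !mulr_ge0.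
have Dp : 0 < D by rewrite lt_neqAle eq_sym Dn0.
have qD : q * D `^ a = (M ^+ 2 / r1 * D) `^ a by rewrite /q -powRM.
have Bq0 : 0 <= 2 * B * q * D `^ a by rewrite !mulr_ge0.
have Cq0 : 0 <= 2 * C * q * D `^ a by rewrite !mulr_ge0.
have CD0 : 0 <= C * D `^ a by rewrite mulr_ge0.
have [far|close] := ltP r1 (M * D).
  have q1 : 1 <= q * D `^ a.
    rewrite qD -[X in X <= _]one_a; apply: ge0_ler_powR; rewrite ?nnegrE ?(ltW a0) //.
      by rewrite mulr_ge0.
    rewrite mulrAC ler_pdivlMr // mul1r.
    apply: le_trans (ltW far) _; rewrite ler_wpM2r // expr2 ler_peMl //; lra.
  have B2 : 2 * B * 1 <= 2 * B * (q * D `^ a) by rewrite ler_wpM2l // mulr_ge0.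
  have := ler_normB (Phi x) (Phi x'); have := PhiB x; have := PhiB x'.
  by lra.
have [N0 HN0] : exists N, r1 < M ^+ N * D.
  exists (Num.truncn (r1 / D)).+1; rewrite -ltr_pdivrMr //.
  apply: lt_le_trans (truncnS_gt _) _.
  apply: (@le_trans _ _ (2 ^+ (Num.truncn (r1 / D)).+1)).
    by rewrite -natrX ler_nat ltnW // ltn_expl.
  by apply: lerXn2r; rewrite ?nnegrE //; lra.
have exN : exists N, r1 < M ^+ N * D by exists N0.
(* The minimal [N] is at least 2 and is written [n.+2]: minimality bounds [M ^ n.+1 * D] by [r1],
   while [r1 < M ^ n.+2 * D] controls [tau ^ n]. The shift from [n] to [n.+2] is the [M ^ 2] in
   [q]. *)
case: (ex_minnP exN) => N HN minN.
case: N HN minN => [|[|n]] HN minN; [|by move: HN; rewrite expr1; lra|].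
  have : 1 * D <= M * D by rewrite ler_wpM2r //; lra.
  by move: HN; rewrite expr0; lra.
have Mn1 : M ^+ n.+1 * D <= r1.
  by rewrite leNgt; apply/negP => /minN; rewrite ltnn.
set u := Lam ^+ n.+1 * D.
have u0 : 0 <= u by rewrite mulr_ge0 ?exprn_ge0.
have u2 : u ^+ 2 = M ^+ n.+1 * D * D by rewrite /u /M -exprM mulnC exprM; ring.
have D1 : D <= 1 by have : 1 * D <= M * D by [rewrite ler_wpM2r //; lra]; lra.
have uD : u `^ alpha <= D `^ a.
  have -> : u `^ alpha = (u ^+ 2) `^ (alpha / 2).
    by rewrite -powR_mulrn // -powRrM; congr (_ `^ _); field.
  apply: (@le_trans _ _ (D `^ (alpha / 2))); last by apply: ger_powR => //; apply/andP.
  apply: ge0_ler_powR; rewrite ?nnegrE ?exprn_ge0 ?divr_ge0 ?(ltW al0) //.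
  by rewrite u2 ler_piMl //; lra.
have ur : u < r.
  apply: le_lt_trans r1r; apply: le_trans Mn1.
  rewrite ler_wpM2r // lerXn2r ?nnegrE // /M expr2 ler_peMl //; lra.
have tauq : tau ^+ n <= q * D `^ a.
  have Man : (M ^+ n) `^ a <= tau ^- n.
    by rewrite powR_exprn_comm // -exprVn; apply: lerXn2r;
      rewrite ?nnegrE ?powR_ge0 ?invr_ge0 ?(ltW tau0).
  have h1 : 1 <= (M ^+ n) `^ a * (q * D `^ a).
    have p0 := mulr_ge0 (exprn_ge0 n M0) (mulr_ge0 Mr0 D0).
    rewrite qD -(powRM _ (exprn_ge0 n M0) (mulr_ge0 Mr0 D0)) -[X in X <= _]one_a.
    apply: ge0_ler_powR; rewrite ?nnegrE ?(ltW a0) //.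
    have -> : M ^+ n * (M ^+ 2 / r1 * D) = M ^+ n.+2 * D / r1.
      by rewrite !exprS expr0; field; rewrite gt_eqF.
    by rewrite ler_pdivlMr // mul1r ltW.
  have h2 : (M ^+ n) `^ a * (q * D `^ a) <= tau ^- n * (q * D `^ a).
    by rewrite ler_wpM2r // mulr_ge0.
  have tn0 : 0 < tau ^+ n by rewrite exprn_gt0.
  by have := le_trans h1 h2; rewrite mulrC ler_pdivlMr // mul1r.
have h1 := approx n x; have h2 := approx n x'; have h3 := local n x x' ur.
rewrite -/D -/u in h3.
have C1 : C * tau ^+ n <= C * (q * D `^ a) by rewrite ler_wpM2l.
have C2 : C * u `^ alpha <= C * D `^ a by rewrite ler_wpM2l.
have -> : Phi x - Phi x' = (Phi x - Phi_ n x) + (Phi_ n x - Phi_ n x') - (Phi x' - Phi_ n x').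
  by ring.
apply: le_trans (ler_normB _ _) _.
have := ler_normD (Phi x - Phi_ n x) (Phi_ n x - Phi_ n x').
by lra.
Qed.

(** * Integration and passage to the limit *)

Section Pairing.
Context {Y : pointedType} {dY : Y -> Y -> R} {alpha k D : R}.
Variable sigma : probability (g_sigma_algebraType (borel_of dY)) R.
Hypotheses (mY : is_metric dY) (a0 : 0 < alpha) (k0 : 0 <= k).
Hypothesis HD : forall y y', dY y y' `^ alpha <= D.

(** Open superlevel sets give measurability for the sigma-algebra generated by the open sets. *)
Lemma holder_cone_superlevel_open psi c : holder_cone dY alpha k psi ->
  mopen dY [set y | c < psi y].
Proof.
move=> [p0 pH] y /= cy.
have K1 : 0 < k * psi y + 1 by rewrite ltr_wpDl // mulr_ge0.
pose e := (psi y - c) / (k * psi y + 1).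
have e0 : 0 < e by rewrite divr_gt0 // subr_gt0.
exists (e `^ alpha^-1); first exact: powR_gt0.
move=> y' yy'.
have de : dY y y' `^ alpha < e.
  rewrite -[X in _ < X](powRr1 (ltW e0)) -(mulVf (lt0r_neq0 a0)) powRrM.
  by apply: (gt0_ltr_powR a0) yy'; rewrite ?nnegrE ?powR_ge0 ?(mdist_ge0 mY).
have h1 : (k * psi y + 1) * dY y y' `^ alpha < psi y - c.
  by rewrite mulrC -ltr_pdivlMr.
have := pH y y' y; have := ler_norm (psi y - psi y').
by have := powR_ge0 (dY y y') alpha; lra.
Qed.

Lemma holder_cone_integrable psi : holder_cone dY alpha k psi ->
  sigma.-integrable setT (EFin \o psi).
Proof.
move=> pC; apply: measurable_bounded_integrable => //.
- by apply: (le_lt_trans (probability_le1 _ _)) => //; rewrite ltry.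
- apply: (measurability _ (measurable_realfun.RGenOInfty.measurableE R)) => //.
  move=> /= _ [_ [c ->]] <-; rewrite setTI preimage_itvoy.
  by apply: sub_sigma_algebra; exact: holder_cone_superlevel_open.
- exists ((1 + k * D) * psi point); split; first exact: num_real.
  move=> M HM y _ /=; rewrite ger0_norm; last by case: pC.
  by apply: le_trans (ltW HM); exact: holder_cone_harnack.
Qed.

Lemma pairing_scale_le psi psi' a : holder_cone dY alpha k psi -> holder_cone dY alpha k psi' ->
  (forall y, a * psi y <= psi' y) -> a * pairing sigma psi <= pairing sigma psi'.
Proof.
move=> /holder_cone_integrable iP /holder_cone_integrable iP' h.
rewrite -(RintegralZl _ measurableT iP); apply: le_Rintegral => //.
exact: (integrableZl _ _ iP).
Qed.

Lemma pairing_le_scale psi psi' b : holder_cone dY alpha k psi -> holder_cone dY alpha k psi' ->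
  (forall y, psi' y <= b * psi y) -> pairing sigma psi' <= b * pairing sigma psi.
Proof.
move=> /holder_cone_integrable iP /holder_cone_integrable iP' h.
rewrite -(RintegralZl _ measurableT iP); apply: le_Rintegral => //.
exact: (integrableZl _ _ iP).
Qed.

Lemma pairing_gt0 psi : holder_cone dY alpha k psi -> (forall y, 0 < psi y) ->
  0 < pairing sigma psi.
Proof.
move=> pC p0; have D0 : 0 <= D by apply: le_trans (powR_ge0 _ _) (HD point point).
have H0 : 0 < 1 + k * D by rewrite ltr_pwDl // mulr_ge0.
(* By Harnack, [psi] is bounded below by this positive constant, whose integral is [c] itself. *)
pose c := psi point / (1 + k * D); have c0 : 0 < c by rewrite divr_gt0.
apply: (lt_le_trans c0); rewrite -[c]mulr1.
have <- : pairing sigma (fun=> 1) = 1.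
  rewrite /pairing -[LHS]/(\int[sigma]_(x in setT) 1) Rintegral_cst //.
  by rewrite (_ : _ setT = 1%E) ?mul1r //; exact: probability_setT.
apply: pairing_scale_le => //; first exact: holder_cone1.
move=> y; rewrite mulr1 /c ler_pdivrMr // mulrC.
exact: holder_cone_harnack.
Qed.

End Pairing.

(** * Limits and logarithms of ratios *)

Lemma nested_intervals (u v : nat -> R) : (forall n m, u n <= v m) ->
  exists l, forall n, u n <= l <= v n.
Proof.
move=> uv; exists (sup (range u)) => n; apply/andP; split.
  by apply: ub_le_sup; [exists (v 0%N) => _ [m _ <-]|exists n].
by apply: ge_sup; [exists (u 0%N), 0%N|move=> _ [m _ <-]].
Qed.

Lemma cvg_geometric_bound (u : nat -> R) (l C tau : R) : 0 < tau < 1 ->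
  (forall n, `|l - u n| <= C * tau ^+ n) -> u @ \oo --> l.
Proof.
move=> /andP[tau0 tau1] H.
have geo : geometric C tau @ \oo --> (0 : R) by apply: cvg_geometric; rewrite gtr0_norm.
apply/(@pseudometric_normed_Zmodule.cvgrPdist_le _ R^o) => e e0.
have [N _ HN] := (@cvgr0_norm_le _ R^o) _ _ _ _ geo _ e0.
exists N => // n Nn; exact: le_trans (H n) (le_trans (ler_norm _) (HN n Nn)).
Qed.

Lemma ln_dist_le (p p' E : R) : 0 < p -> 0 < p' ->
  p <= expR E * p' -> p' <= expR E * p -> `|ln p - ln p'| <= E.
Proof.
move=> p0 p'0; rewrite -ler_ln ?posrE ?mulr_gt0 ?expR_gt0 // lnM ?posrE ?expR_gt0 // expRK => h1.
rewrite -ler_ln ?posrE ?mulr_gt0 ?expR_gt0 // lnM ?posrE ?expR_gt0 // expRK => h2.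
by rewrite ler_norml; lra.
Qed.

Lemma ln_gap_le (a0 a b : R) : 0 < a0 -> a0 <= a -> a <= b -> ln b - ln a <= (b - a) / a0.
Proof.
move=> a00 a0a ab; have ap : 0 < a by apply: lt_le_trans a0a.
have bp : 0 < b by apply: lt_le_trans ab.
rewrite -ln_div ?posrE //; have -> : b / a = 1 + (b - a) / a by field; rewrite gt_eqF.
have g0 : 0 <= (b - a) / a by rewrite divr_ge0 ?subr_ge0 // ltW.
apply: le_trans (le_ln1Dx _) _; first by lra.
by rewrite ler_wpM2l ?subr_ge0 // lef_pV2 ?posrE.
Qed.

Lemma expR_lipschitz (B a b : R) : a <= B -> b <= B -> `|expR a - expR b| <= expR B * `|a - b|.
Proof.
have key (u v : R) : u <= v -> v <= B -> expR v - expR u <= expR B * (v - u).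
  move=> uv vB; have -> : expR u = expR v * expR (u - v) by rewrite -exp.expRD; congr expR; ring.
  have h1 : expR v * (1 + (u - v)) <= expR v * expR (u - v).
    by rewrite ler_wpM2l ?expR_ge0 // expR_ge1Dx.
  have h2 : expR v * (v - u) <= expR B * (v - u) by rewrite ler_wpM2r ?subr_ge0 // ler_expR.
  by lra.
move=> aB bB; have [ab|/ltW ba] := leP a b.
  by rewrite distrC (distrC a) !ger0_norm ?subr_ge0 ?ler_expR //; apply: key.
by rewrite !ger0_norm ?subr_ge0 ?ler_expR //; apply: key.
Qed.

(** A real [sup] bounds its set only if the set is bounded above; the a priori constant [H] provides
    this. *)
Lemma holder_seminormP {S : Type} {dS : S -> S -> R} (h : S -> R) (a H : R) z z' :
  is_metric dS -> 0 < a -> (forall x y, `|h x - h y| <= H * dS x y `^ a) ->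
  `|h z - h z'| <= holder_seminorm dS a h * dS z z' `^ a.
Proof.
move=> mS a0 hH; have [->|zz'] := pselect (z = z').
  by rewrite subrr normr0 (mdistxx mS) powR0 ?mulr0 // gt_eqF.
have pos x y : x <> y -> 0 < dS x y `^ a.
  move=> xy; apply: powR_gt0; rewrite lt_neqAle (mdist_ge0 mS) andbT eq_sym.
  by apply/eqP => /(mdist_eq0 mS).
rewrite -ler_pdivrMr ?pos //; apply: ub_le_sup; last by exists z, z'.
by exists H => _ [x [y [xy ->]]]; rewrite ler_pdivrMr ?pos.
Qed.

(** The intervals from [ln a] to [ln b] meet pairwise, since any two contain a late term of the
    sequence of [i0]; so they share a point. They do not depend on [i], hence neither does the
    limit. *)
Lemma log_ratio_limit {I : Type} (i0 : I) (rho : I -> nat -> R) (a0 b0 tau : R) : 0 < a0 ->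
  (forall n, exists a b, [/\ a0 <= a, a <= b, b <= b0, b - a <= b0 * tau ^+ n &
     forall i j, (n <= j)%N -> a <= rho i j <= b]) ->
  exists l, ln a0 <= l <= ln b0 /\ forall i j, `|l - ln (rho i j)| <= b0 / a0 * tau ^+ j.
Proof.
move=> a00 H.
have /choice[ab Hab] : forall n, exists ab : R * R,
    [/\ a0 <= ab.1, ab.1 <= ab.2, ab.2 <= b0, ab.2 - ab.1 <= b0 * tau ^+ n &
     forall i j, (n <= j)%N -> ab.1 <= rho i j <= ab.2].
  by move=> n; have [a [b h]] := H n; exists (a, b).
have a_gt0 n : 0 < (ab n).1 by have [h _ _ _ _] := Hab n; exact: lt_le_trans h.
have ln_rho n i j : (n <= j)%N -> ln (ab n).1 <= ln (rho i j) <= ln (ab n).2.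
  move=> nj; have [_ h _ _ /(_ i j nj) /andP[h1 h2]] := Hab n; have p := a_gt0 n.
  have q := lt_le_trans p h1.
  by rewrite !ler_ln ?posrE ?h1 ?h2 // (lt_le_trans q).
have [l Hl] : exists l, forall n, ln (ab n).1 <= l <= ln (ab n).2.
  apply: nested_intervals => n m.
  have /andP[h1 _] := ln_rho n i0 (maxn n m) (leq_maxl _ _).
  have /andP[_ h2] := ln_rho m i0 (maxn n m) (leq_maxr _ _).
  exact: le_trans h1 h2.
exists l; split.
  have [h1 h2 h3 _ _] := Hab 0%N; have /andP[l1 l2] := Hl 0%N.
  have p := a_gt0 0%N; have q := lt_le_trans p h2.
  apply/andP; split; first by apply: le_trans l1; rewrite ler_ln ?posrE.
  by apply: (le_trans l2); rewrite ler_ln ?posrE // (lt_le_trans q).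
move=> i j; have [h1 h2 _ h4 _] := Hab j.
have := ln_gap_le a0 _ _ a00 h1 h2; have := Hl j; have := ln_rho j i j (leqnn j).
have : ((ab j).2 - (ab j).1) / a0 <= b0 / a0 * tau ^+ j.
  by rewrite mulrAC ler_wpM2r // invr_ge0 ltW.
by rewrite ler_norml; lra.
Qed.

(** * Existence and Holder continuity of the limit *)

Theorem theorem3p13
  (X Y : pointedType) (dX : X -> X -> R) (dY : Y -> Y -> R)
  (f : X -> X) (g : X -> Y -> Y) (d : nat)
  (gamma delta_f : R) (Lfun : X * Y -> R) (Lc : R) (A : set (X * Y))
  (q : nat) (phi : X * Y -> R) (alpha eps_phi eps iota : R)
  (* X, Y compact connected (Riemannian) manifolds *)
  (HX : compact_connected_manifold dX) (HY : compact_connected_manifold dY)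
  (* F is a Lipschitz local homeomorphism of (X * Y, dX + dY) *)
  (HFlip : lipschitz_map (dprod dX dY) (dprod dX dY) (skewF f g))
  (HFloc : local_homeomorphism (dprod dX dY) (skewF f g))
  (* f is uniformly expanding *)
  (Hgamma : 1 < gamma) (Hdelta : 0 < delta_f)
  (Hexp : forall x x', dX x x' <= delta_f -> dX (f x) (f x') >= gamma * dX x x')
  (* every y has exactly d preimages under each g_x *)
  (Hdeg : forall x y, (g x @^-1` [set y] #= `I_d)%card)
  (* the local inverse Lipschitz constants L(z) *)
  (HLcont : mcont_on (dprod dX dY) (fun a b : R => `|a - b|) setT Lfun)
  (HLloc : forall z, exists U : set (X * Y),
     [/\ mopen (dprod dX dY) U, U z, injective_on U (skewF f g) &
      forall w w', U w -> U w' ->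
        dprod dX dY w w' <= Lfun z * dprod dX dY (skewF f g w) (skewF f g w')])
  (HLc : 1 <= Lc) (HAopen : mopen (dprod dX dY) A)
  (* (A1) *)
  (HA1in : forall z, A z -> Lfun z <= Lc)
  (HA1out : forall z, ~ A z -> Lfun z < gamma^-1)
  (* (A2) *)
  (HA2 : exists (N : nat) (Ucov : nat -> set (X * Y)),
     [/\ forall i, (i < N)%N -> mopen (dprod dX dY) (Ucov i),
         forall z, exists2 i, (i < N)%N & Ucov i z,
         forall i, (i < N)%N -> injective_on (Ucov i) (skewF f g),
         exists J : seq nat, [/\ uniq J, size J = q, all (fun j => j < N)%N J &
            forall z, A z -> exists2 j, j \in J & Ucov j z] &
         forall i, (i < N)%N -> forall (l : R) (c c1 c2 : R -> X * Y),
           min_geodesic (dprod dX dY) l c ->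
           mcont_on (fun a b : R => `|a - b|) (dprod dX dY) `[0, l] c1 ->
           mcont_on (fun a b : R => `|a - b|) (dprod dX dY) `[0, l] c2 ->
           (forall t, 0 <= t <= l -> skewF f g (c1 t) = c t) ->
           (forall t, 0 <= t <= l -> skewF f g (c2 t) = c t) ->
           (exists t, 0 <= t <= l /\ Ucov i (c1 t)) ->
           (exists t, 0 <= t <= l /\ Ucov i (c2 t)) ->
           forall t, 0 <= t <= l -> c1 t = c2 t])
  (Hqd : (q < d)%N)
  (* the potential *)
  (Halpha : 0 < alpha < 1) (Hphi : holder (dprod dX dY) alpha phi)
  (Heps_phi : 0 < eps_phi < ln d%:R - ln q%:R)
  (Hs1 : expR eps_phi * ((d - q)%:R * gamma `^ (- alpha) + q%:R * Lc `^ alpha) / d%:R < 1)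
  (Hs2 : let s := expR eps_phi * ((d - q)%:R * gamma `^ (- alpha) + q%:R * Lc `^ alpha) / d%:R in
         s + 2 * s * eps_phi * diam dY `^ alpha < 1)
  (HP1 : sup (range phi) - inf (range phi) < eps_phi)
  (HP2 : holder_seminorm (dprod dX dY) alpha (fun z => expR (phi z))
           < eps_phi * expR (inf (range phi)))
  (* the fixed constants eps, iota and c *)
  (Heps : 0 < eps) (Heps2 : q%:R * expR eps * expR eps_phi / d%:R < 1)
  (Hiota : 0 < iota < 1)
  (Hcount : exists2 C : R, 0 < C & forall n : nat,
     (#|[pred w : {ffun 'I_n -> 'I_d} |
         iota * n%:R <= (#|[pred i : 'I_n | (w i < q)%N]|)%:R]|)%:R
       <= C * q%:R ^+ n * expR (eps * n%:R))
  (Hc : exists2 c : R, 0 < c &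
     gamma `^ (- (1 - iota)) * Lc `^ iota < expR (- (2 * c)) /\ expR (- (2 * c)) < 1) :
  exists Phi : X -> R,
    (forall (sigma : probability (g_sigma_algebraType (borel_of dY)) R) (x : X),
       (fun n : nat =>
          ln (pairing sigma (Lopn f g phi n.+1 x (fun=> 1)) /
              pairing sigma (Lopn f g phi n (f x) (fun=> 1))))
       @ \oo --> Phi x)
    /\ holder_continuous dX Phi.
Proof.
have [mX cX _ _ _] := HX; have [mY cY _ _ gY] := HY.
have mZ := dprod_metric mX mY; have cZ := dprod_compact cX cY.
have [al0 al1] := andP Halpha; have [ep0 _] := andP Heps_phi.
have gam0 : 0 < gamma by apply: lt_trans Hgamma.
have d0 : (0 < d)%N by apply: leq_ltn_trans Hqd.
have [H [H0 phiH]] : exists H, 0 <= H /\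
    forall z z', `|phi z - phi z'| <= H * dprod dX dY z z' `^ alpha.
  have [H HH] := Hphi; exists `|H|; split=> // z z'; apply: le_trans (HH z z') _.
  by rewrite ler_wpM2r ?powR_ge0 // ler_norm.
have [DZ HDZ] := compact_bounded mZ cZ; have [DY HDY] := compact_bounded mY cY.
have [B phiB] : exists B, forall z, `|phi z| <= B.
  exists (`|phi point| + H * DZ `^ alpha) => z.
  have h := phiH z point; have p := mdist_ge0 mZ z point.
  have : dprod dX dY z point `^ alpha <= DZ `^ alpha.
    by apply: ge0_ler_powR; rewrite ?nnegrE ?(ltW al0) // (le_trans p).
  move=> /(ler_wpM2l H0); have := ler_normD (phi z - phi point) (phi point).
  by rewrite subrK; lra.
have phiB1 z : phi z <= B by apply: le_trans (ler_norm _) (phiB z).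
have phiB2 z : - B <= phi z by have := phiB z; rewrite ler_norml => /andP[].
set m := inf (range phi) in HP1 HP2.
have phi_ge z : m <= phi z.
  by apply: ge_inf; [exists (- B) => _ [w _ <-]|exists z].
have phi_le z : phi z <= m + eps_phi.
  have : phi z <= sup (range phi) by apply: ub_le_sup; [exists B => _ [w _ <-]|exists z].
  by lra.
(* Within one fibre the product distance reduces to [dY], so (P) gives the oscillation bound used
   for the cones. *)
have phi_holder x y y' : `|expR (phi (x, y)) - expR (phi (x, y'))| <=
    eps_phi * expR m * dY y y' `^ alpha.
  have := @holder_seminormP _ _ (fun z => expR (phi z)) alpha (expR B * H) (x, y) (x, y') mZ al0.
  rewrite !dprodE /= (mdistxx mX) add0r => h; apply: le_trans (h _) _.
    move=> z z'; apply: le_trans (expR_lipschitz B _ _ _ _) _ => //.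
    by rewrite -mulrA ler_wpM2l ?expR_ge0.
  by rewrite ler_wpM2r ?powR_ge0 // ltW.
pose D := diam dY `^ alpha.
have HD y y' : dY y y' `^ alpha <= D.
  have dd : dY y y' <= diam dY.
    by apply: ub_le_sup; [exists DY => _ [w [w' ->]]|exists y, y'].
  apply: ge0_ler_powR => //; rewrite ?nnegrE ?(ltW al0) ?(mdist_ge0 mY) //.
  exact: le_trans (mdist_ge0 mY y y') dd.
pose N := (d - q)%:R * gamma `^ (- alpha) + q%:R * Lc `^ alpha.
have N0 : 0 <= N by rewrite addr_ge0 // mulr_ge0 ?powR_ge0.
have Hpair x y y' := fibre_pairing_sum mX mY cX cY HFlip HFloc Hgamma Hdelta Hexp Hdeg HLloc
  gY HLc HA1in HA1out HA2 Hqd alpha x y y' al0.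
have [k [k1 [k10 kk1 Lcone]]] :=
  contracted_cone_exists Hdeg d0 Hpair HD ep0 phi_ge phi_le phi_holder N0 Hs2.
have [a0 [b0 [tau [a00 b00 tau0 tau1 ratio]]]] :=
  Lopn_ratio_bounds (f := f) Hdeg d0 HD ep0 phi_ge phi_le k10 kk1 Lcone.
have k0 : 0 <= k by apply: le_trans k10 (ltW kk1).
have cone_one n x : holder_cone dY alpha k (Lopn f g phi n x (fun=> 1)).
  by apply: (Lopn_cone kk1 Lcone); exact: holder_cone1.
have pos n x y : 0 < Lopn f g phi n x (fun=> 1) y by exact: Lopn1_gt0.
pose pr := probability (g_sigma_algebraType (borel_of dY)) R.
(* [None] is evaluation at [point]. It shares the limit of every [sigma] and supplies approximants
   for the Holder estimate without integration. *)
pose eval (i : option pr) psi := if i is Some sigma then pairing sigma psi else psi point.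
pose rho x i j := eval i (Lopn f g phi j.+1 x (fun=> 1)) / eval i (Lopn f g phi j (f x) (fun=> 1)).
have eval_gt0 i n x : 0 < eval i (Lopn f g phi n x (fun=> 1)).
  by case: i => [sigma|] /=; [apply: (pairing_gt0 sigma mY al0 k0 HD)|].
have /choice[Phi HPhi] : forall x, exists l, ln a0 <= l <= ln b0 /\
    forall i j, `|l - ln (rho x i j)| <= b0 / a0 * tau ^+ j.
  move=> x; apply: (log_ratio_limit None) => // n.
  have [a [b [aa0 ab bb0 gap Hab]]] := ratio x n; exists a, b; split=> // i j nj.
  rewrite /rho ler_pdivlMr // ler_pdivrMr //.
  apply/andP; case: i => [sigma|] /=; last by apply/andP/Hab.
  split.
    by apply: (pairing_scale_le sigma mY al0 k0 HD _ _ _ (cone_one j (f x)) (cone_one j.+1 x)) => y;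
      case/andP: (Hab j y nj).
  by apply: (pairing_le_scale sigma mY al0 k0 HD _ _ _ (cone_one j (f x)) (cone_one j.+1 x)) => y;
      case/andP: (Hab j y nj).
exists Phi; split.
  move=> sigma x; apply: (@cvg_geometric_bound _ _ (b0 / a0) tau); first by rewrite tau0.
  by move=> n; have [_ h] := HPhi x; exact: (h (Some sigma) n).
have [Lam0 Lam01 base_lip0] := base_lipschitz mX mY HFlip.
pose Lam := Lam0 + 1; have Lam2 : 2 <= Lam by rewrite /Lam; lra.
have Lam1 : 1 < Lam by lra.
have base_lip x x' : dX (f x) (f x') <= Lam * dX x x'.
  by have := base_lip0 x x'; have := mdist_ge0 mX x x'; rewrite /Lam; lra.
have [r r0 [K K0 near]] :=
  nearby_fibres_pairing mX mY cX cY HFlip HFloc Hgamma Hdelta Hexp Hdeg HLloc.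
have [c c0 nearby] :=
  Lopn_nearby Hdeg mX mY al0 k0 Lam1 K0 H0 base_lip near phiH cone_one.
(* [b0 / a0] is the constant of exponential convergence; [2 * c] accounts for numerator and
   denominator of the ratio. *)
pose C := b0 / a0 + 2 * c.
have ba0 : 0 <= b0 / a0 by rewrite divr_ge0 // ltW.
apply: (@holder_of_exponential_approx _ _ Phi (fun n x => ln (rho x None n)) C tau Lam alpha r
  (`|ln a0| + `|ln b0|)) => //.
- by rewrite /C addr_ge0 // mulr_ge0.
- by rewrite tau0.
- move=> x; have [/andP[h1 h2] _] := HPhi x.
  have := ler_norm (ln b0); have := ler_norm (- ln a0); rewrite normrN.
  have := normr_ge0 (ln a0); have := normr_ge0 (ln b0).
  by rewrite ler_norml; lra.
- move=> n x; have [_ h] := HPhi x; apply: le_trans (h None n) _.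
  by rewrite ler_wpM2r ?exprn_ge0 ?(ltW tau0) // lerDl mulr_ge0.
- move=> n x x' small.
  set u := Lam ^+ n.+1 * dX x x' in small *.
  have Lam_ge0 : 0 <= Lam by lra.
  have ua0 : 0 <= u `^ alpha by exact: powR_ge0.
  (* The denominator runs for one step less but starts at [f x], so both comparisons take place on
     the scale [u]. *)
  have ufx : Lam ^+ n * dX (f x) (f x') <= u.
    by rewrite /u exprSr -mulrA ler_wpM2l ?exprn_ge0.
  have near1 y : `|ln (Lopn f g phi n.+1 x (fun=> 1) y) - ln (Lopn f g phi n.+1 x' (fun=> 1) y)|
      <= c * u `^ alpha.
    apply: ln_dist_le => //; first exact: nearby.
    by rewrite /u (mdistC mX); apply: nearby; rewrite (mdistC mX).
  have near2 y : `|ln (Lopn f g phi n (f x) (fun=> 1) y) - ln (Lopn f g phi n (f x') (fun=> 1) y)|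
      <= c * u `^ alpha.
    apply: (@le_trans _ _ (c * (Lam ^+ n * dX (f x) (f x')) `^ alpha)).
      have s := le_lt_trans ufx small.
      apply: ln_dist_le => //; first exact: nearby.
      by rewrite (mdistC mX); apply: nearby; rewrite (mdistC mX).
    apply: ler_wpM2l => //; apply: ge0_ler_powR ufx; rewrite ?nnegrE ?(ltW al0) //.
      by rewrite mulr_ge0 ?exprn_ge0 ?(mdist_ge0 mX).
    by rewrite mulr_ge0 ?exprn_ge0 ?(mdist_ge0 mX).
  rewrite /rho /eval !ln_div ?posrE //.
  set p1 := ln _; set p2 := ln _; set p3 := ln _; set p4 := ln _.
  have h1 : `|p1 - p3| <= c * u `^ alpha by exact: near1.
  have h2 : `|p2 - p4| <= c * u `^ alpha by exact: near2.
  have -> : p1 - p2 - (p3 - p4) = (p1 - p3) - (p2 - p4) by ring.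
  have h3 : 0 <= b0 / a0 * u `^ alpha by rewrite mulr_ge0.
  by apply: le_trans (ler_normB _ _) _; rewrite /C; lra.
Qed.
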